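(* Let $d\ge 2$. There are exactly $2^{d-1}$ essential pattern groups $P\le G(d)$ of pattern size $d$ such that the finitely constrained group $G_P$ of binary rooted tree automorphisms defined by $P$ has Hausdorff dimension $\dim_{\mathcal{H}}(G_P)=1-\frac{1}{2^{d-1}}$, and each of them is a maximal subgroup of $G(d)$.
   Context: Let $X=\{0,1\}$, let $X^n$ be the set of words of length $n$ over $X$, and let $X^*=\bigcup_{n\ge 0}X^n$, viewed as the binary rooted tree with root the empty word $\emptyset$, in which each vertex $w$ has the two children $w0,w1$. Put $X^{[d]}=\bigcup_{i=0}^{d}X^i$ (the finite binary rooted tree of depth $d$) and $X^{(d)}=\bigcup_{i=0}^{d-1}X^i$. Let $G=\mathrm{Aut}(X^* )$ and $G(d)=\mathrm{Aut}(X^{[d]})$ be the groups of rooted tree automorphisms, acting on the left. For $g\in G$ and $w\in X^*$, the section $g_w\in G$ is the unique automorphism with $g(wv)=g(w)g_w(v)$ for all $v \in X^*$. The label (activity) $g_{(w)}\in C_2=\{0,1\}$ of $g$ at $w$ is $1$ if $g_w$ exchanges the two vertices of $X^1$, and $0$ otherwise. Labels $g_{(w)}$ for $g\in G(d)$ and $w\in X^{(d)}$ are defined in the same way. An element of $G(d)$ is determined by its labels, and $G(d)$ is thereby identified with the set of all maps $X^{(d)}\to C_2$ (patterns of size $d$). A pattern group of size $d$ is a subgroup $P\le G(d)$. It is essential if for all $g\in P$ and $i\in\{0,1\}$ there is $h_i\in P$ with $(h_i)_{(w)}=g_{(iw)}$ for all $w\in X^{(d-1)}$. The finitely constrained group defined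 by $P$ is $G_P=\{g\in G \mid \text{for every } w\in X^* \text{ the pattern } X^{(d)} \to C_2,\ v\mapsto g_{(wv)}, \text{ belongs to } P\}$; it is a closed subgroup of $G$. Equip $G$ with the metric in which the distance between $g\ne h$ is $1/[G:G_n]$, where $G_n$ is the pointwise stabilizer of $X^n$ in $G$ and $n$ is the smallest $k$ for which there is $u\in X^k$ with $g_{(u)}\neq h_{(u)}$. The Hausdorff dimension $\dim_{\mathcal{H}}(H)$ of a closed subgroup $H$ of $G$ is taken with respect to this metric; it is given by $\dim_{\mathcal{H}}(H)=\liminf_{n\to\infty}\frac{\log_2[H:H_n]}{2^n-1}$, where $H_n=H\cap G_n$. *)

(* Defs.v *)
From HB Require Import structures.
From mathcomp Require Import all_boot all_order all_algebra all_fingroup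
  all_solvable.
From mathcomp Require Import finmap.
From mathcomp Require Import all_classical all_reals all_analysis.

Set Implicit Arguments.
Unset Strict Implicit.
Unset Printing Implicit Defensive.

Import Order.TTheory GRing.Theory Num.Theory.

Local Open Scope classical_set_scope.

(** Words over X = {0,1} are [seq bool] (0 is [false], 1 is [true]); the
    children of [w] are [rcons w false] and [rcons w true]. *)

Definition child (u v : seq bool) : bool :=
  (v == rcons u false) || (v == rcons u true).

Definition adjacent (u v : seq bool) : bool := child u v || child v u.

(** Automorphisms of a rooted tree whose vertices [t : T] are words [word t];
    this is used for X^* ([T = seq bool]) and X^[d] ([T = d.-bseq bool]). *)
Definition rooted_aut (T : Type) (word : T -> seq bool) (f : T -> T) : Prop :=
  [/\ bijective f,
      forall t, word t = [::] -> word (f t) = [::] &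
      forall t u, adjacent (word (f t)) (word (f u)) =
                  adjacent (word t) (word u)].

Lemma rooted_aut_id (T : Type) (word : T -> seq bool) : rooted_aut word id.
Proof. by split=> //; exists id. Qed.

Lemma rooted_aut_comp (T : Type) (word : T -> seq bool) (f g : T -> T) :
  rooted_aut word f -> rooted_aut word g -> rooted_aut word (f \o g).
Proof.
move=> [bf rf af] [bg rg ag]; split; first exact: bij_comp.
  by move=> t /rg /rf.
by move=> t u /=; rewrite af ag.
Qed.

Lemma rooted_aut_inv (f g : seq bool -> seq bool) :
  cancel f g -> cancel g f -> rooted_aut id f -> rooted_aut id g.
Proof.
move=> fK gK [_ rf af]; split; first by exists f.
  by move=> t /= ->; rewrite -[X in g X](rf [::]) ?fK.
by move=> t u; rewrite -af !gK.
Qed.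

(** G = Aut(X^* ) acts on the left: [(g * h) w = g (h w)]. *)
Record treeAut := TreeAut {
  treeAut_fun :> seq bool -> seq bool;
  treeAutP : rooted_aut id treeAut_fun
}.

Lemma treeAut_eq (g h : treeAut) : g =1 h -> g = h.
Proof.
case: g h => [f fP] [f' f'P] /= /funext eff'; move: f'P; rewrite -eff' => f'P.
by congr TreeAut; exact: Prop_irrelevance.
Qed.

HB.instance Definition _ := gen_eqMixin treeAut.
HB.instance Definition _ := gen_choiceMixin treeAut.

Definition treeAut_one : treeAut := TreeAut (@rooted_aut_id _ id).

Definition treeAut_mul (g h : treeAut) : treeAut :=
  TreeAut (rooted_aut_comp (treeAutP g) (treeAutP h)).

Lemma treeAut_inv_ex (g : treeAut) :
  exists h : treeAut, cancel g h /\ cancel h g.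
Proof.
have [[h gK hK] _ _] := treeAutP g.
by exists (TreeAut (rooted_aut_inv gK hK (treeAutP g))).
Qed.

Definition treeAut_inv (g : treeAut) : treeAut :=
  projT1 (cid (treeAut_inv_ex g)).

Lemma treeAut_mulA : associative treeAut_mul.
Proof. by move=> f g h; exact: treeAut_eq. Qed.

Lemma treeAut_mul1 : left_id treeAut_one treeAut_mul.
Proof. by move=> g; exact: treeAut_eq. Qed.

Lemma treeAut_1mul : right_id treeAut_one treeAut_mul.
Proof. by move=> g; exact: treeAut_eq. Qed.

Lemma treeAut_mulV : left_inverse treeAut_one treeAut_inv treeAut_mul.
Proof.
move=> g; apply: treeAut_eq => w /=.
by rewrite /treeAut_inv; case: cid => h [gK hK] /=; rewrite gK.
Qed.

Lemma treeAut_Vmul : right_inverse treeAut_one treeAut_inv treeAut_mul.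
Proof.
move=> g; apply: treeAut_eq => w /=.
by rewrite /treeAut_inv; case: cid => h [gK hK] /=; rewrite hK.
Qed.

HB.instance Definition _ := isGroup.Build treeAut
  treeAut_mulA treeAut_mul1 treeAut_1mul treeAut_mulV treeAut_Vmul.

(** The finite group G(d) = Aut(X^[d]). The product of permutations in
    MathComp is that of right actions, i.e. opposite to composition; both
    products have the same subgroups. *)

Definition finAut (d : nat) : {set {perm d.-bseq bool}} :=
  [set g : {perm d.-bseq bool} | `[< rooted_aut (@bseqval d bool) g >]]%SET.

Lemma finAut_group_set (d : nat) : group_set (finAut d).
Proof.
apply/group_setP; split=> [|g h].
  rewrite finset.in_set; apply/asboolP.
  have -> : fun_of_perm (1%g : {perm d.-bseq bool}) = id.
    by apply/funext => t; rewrite perm1.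
  exact: rooted_aut_id.
rewrite !finset.in_set => /asboolP ag /asboolP ah; apply/asboolP.
have -> : fun_of_perm (g * h)%g = h \o g by apply/funext => t; rewrite permM.
exact: rooted_aut_comp.
Qed.

Canonical finAut_group (d : nat) := Group (finAut_group_set d).

(** The action of an element of G(d) on words of length at most d (the values
    on longer words are irrelevant). *)
Definition word_act (d : nat) (g : {perm d.-bseq bool}) (w : seq bool) :
  seq bool := g (insub_bseq d w).

(** For a tree automorphism [f] this is the section, characterized by
    [f (w ++ v) = f w ++ section_at f w v] (lemma [treeAut_sectionE]). *)
Definition section_at (f : seq bool -> seq bool) (w v : seq bool) : seq bool :=
  drop (size (f w)) (f (w ++ v)).

Definition label (f : seq bool -> seq bool) (w : seq bool) : bool :=
  (section_at f w [:: false] == [:: true]) &&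
  (section_at f w [:: true] == [:: false]).

Lemma treeAut_child (g : treeAut) (u : seq bool) (x : bool) :
  child (g u) (g (rcons u x)).
Proof.
have [bg rg ag] := treeAutP g; have ig := bij_inj bg.
have adjx v y : child v (rcons v y) by rewrite /child; case: y; rewrite eqxx ?orbT.
have childP v w : child v w -> exists y, w = rcons v y.
  by case/orP=> /eqP->; [exists false | exists true].
elim/last_ind: u x => [|u z IHu] x.
  have := ag [::] [:: x]; rewrite /adjacent (rg [::] erefl) (adjx [::] x) /=.
  by case/orP=> // /childP[y /(congr1 size)]; rewrite size_rcons.
have := ag (rcons u z) (rcons (rcons u z) x).
rewrite /adjacent (adjx (rcons u z) x) /= => /orP[//|/childP[y Ey]].
have [y' Ey'] := childP _ _ (IHu z).
move: Ey; rewrite Ey' => /rcons_inj[/ig Eu _].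
by move/(congr1 size): Eu; rewrite !size_rcons => /eqP; rewrite ltn_eqF.
Qed.

Lemma treeAut_sectionE (g : treeAut) (w v : seq bool) :
  g (w ++ v) = g w ++ section_at g w v.
Proof.
suff [s Es] : exists s, g (w ++ v) = g w ++ s.
  by rewrite /section_at Es drop_size_cat.
elim/last_ind: v => [|v x [s IHv]]; first by exists [::]; rewrite !cats0.
have := treeAut_child g (w ++ v) x.
rewrite IHv rcons_cat /child => /orP[]/eqP->; rewrite rcons_cat.
  by exists (rcons s false).
by exists (rcons s true).
Qed.

Definition pattern_group (d : nat) (P : {group {perm d.-bseq bool}}) : Prop :=
  P \subset finAut d.

Definition essential (d : nat) (P : {group {perm d.-bseq bool}}) : Prop :=
  forall (g : {perm d.-bseq bool}) (i : bool), g \in P ->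
  exists2 h : {perm d.-bseq bool}, h \in P &
    forall w : seq bool, (size w < d.-1)%N ->
      label (word_act h) w = label (word_act g) (i :: w).

Definition fin_constrained (d : nat) (P : {group {perm d.-bseq bool}}) :
  set treeAut :=
  [set g : treeAut | forall w : seq bool,
     exists2 p : {perm d.-bseq bool}, p \in P &
       forall v : seq bool, (size v < d)%N ->
         label (word_act p) v = label g (w ++ v)].

(** The number of left cosets [g H]; it is 0 when that number is infinite. *)
Definition group_index (gT : groupType) (H : set gT) : nat :=
  #|` fset_set [set [set (g * h)%g | h in H] | g in [set: gT]]|.

Definition level_stab (n : nat) : set treeAut :=
  [set g : treeAut | forall u : seq bool, size u = n -> g u = u].

Definition labels_differ (g h : treeAut) (k : nat) : Prop :=
  exists2 u : seq bool, size u = k & label g u <> label h u.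

Definition first_diff_level (g h : treeAut) : nat :=
  xget 0%N [set k | labels_differ g h k /\
                    forall j, labels_differ g h j -> (k <= j)%N].

Definition aut_dist (R : realType) (g h : treeAut) : R :=
  (if g == h then 0 else (group_index (level_stab (first_diff_level g h)))%:R^-1)%R.

Local Open Scope ereal_scope.

(** The diameter of the empty set is 0. *)
Definition diameter (R : realType) (T : Type) (dist : T -> T -> R)
    (A : set T) : \bar R :=
  ereal_sup ([set 0] `|` [set (dist x.1 x.2)%:E | x in A `*` A]).

Definition hausdorff_premeasure (R : realType) (T : Type) (dist : T -> T -> R)
    (s delta : R) (A : set T) : \bar R :=
  ereal_inf [set \sum_(0 <= i <oo) diameter dist (U i) `^ s |
    U in [set U : nat -> set T | A `<=` \bigcup_i U i /\
                                 forall i, diameter dist (U i) <= delta%:E]].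

Definition hausdorff_measure (R : realType) (T : Type) (dist : T -> T -> R)
    (s : R) (A : set T) : \bar R :=
  ereal_sup [set hausdorff_premeasure dist s delta A |
    delta in [set delta : R | (0 < delta)%R]].

(** Only [s > 0] is considered, so that the convention for [0 `^ 0] plays no
    role; leaving out [s = 0] does not change the infimum. *)
Definition hausdorff_dim (R : realType) (T : Type) (dist : T -> T -> R)
    (A : set T) : \bar R :=
  ereal_inf [set s%:E | s in
    [set s : R | (0 < s)%R /\ hausdorff_measure dist s A = 0]].

(* Main.v *)
Require Import Defs.
From HB Require Import structures.
From mathcomp Require Import all_boot all_order all_algebra all_fingroup
  all_solvable.
From mathcomp Require Import finmap.
From mathcomp Require Import all_classical all_reals all_analysis.
From mathcomp Require Import zify ring lra.

Import Order.TTheory GRing.Theory Num.Theory.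
Local Open Scope ring_scope.

(** Let [B] be the group of rows of labels that can be put on the last level
    [e = d - 1] of an element of [P] trivial above it, and [|B| = 2 ^ b]. If [P]
    is essential, then every admissible portrait of height [n >= d] has exactly
    [|B| ^ (2 ^ (n - e))] admissible extensions to height [n + 1]. Hence about
    [2 ^ (b * 2 ^ (n - e))] cylinders of diameter [2 ^ (1 - 2 ^ n)] cover the
    group, while by compactness a cover by cylinders of heights [n_i] satisfies
    [sum_i 2 ^ (- b * 2 ^ (n_i - e)) >= 2 ^ (- 2 * b)]; so the dimension is
    [b / 2 ^ e], and it is [1 - 1 / 2 ^ e] if and only if [B] has index two
    among all rows.

    In that case essentiality makes [P] surject onto [G (d - 1)], so [P] is
    transitive on level [e], [B] is the group of rows of even parity, and [P] is
    the kernel of a character of [G d] to the group with two elements.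
    Conjugation in [G d] is transitive on each level, so such a character is a
    sum of parities of levels; level [e] must occur, and the other levels are
    arbitrary. *)

Set Implicit Arguments.
Unset Strict Implicit.
Unset Printing Implicit Defensive.

Implicit Types (l r f : seq bool -> bool) (u v w : seq bool).

(** * Portraits *)

(** The tree automorphism with labels [l]: each letter is changed by the label at the prefix read so
    far. In [pact_inv] that prefix is the one already output. *)
Fixpoint pact (l : seq bool -> bool) (w : seq bool) : seq bool :=
  if w is x :: w' then (l [::] (+) x) :: pact (fun v => l (x :: v)) w'
  else [::].

Fixpoint pact_inv (l : seq bool -> bool) (w : seq bool) : seq bool :=
  if w is x :: w' then
    (l [::] (+) x) :: pact_inv (fun v => l ((l [::] (+) x) :: v)) w'
  else [::].

Lemma pactK l : cancel (pact l) (pact_inv l).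
Proof. by move=> w; elim: w l => //= x w IH l; rewrite addbA addbb /= IH. Qed.

Lemma pact_invK l : cancel (pact_inv l) (pact l).
Proof. by move=> w; elim: w l => //= x w IH l; rewrite IH addbA addbb. Qed.

Lemma pact_inj l : injective (pact l).
Proof. exact: can_inj (pactK l). Qed.

Lemma size_pact l w : size (pact l w) = size w.
Proof. by elim: w l => //= x w IH l; rewrite IH. Qed.

Lemma pact_cat l w v : pact l (w ++ v) = pact l w ++ pact (fun u => l (w ++ u)) v.
Proof. by elim: w l => //= x w IH l; rewrite IH. Qed.

Lemma pact_rcons l w x : pact l (rcons w x) = rcons (pact l w) (l w (+) x).
Proof. by rewrite -!cats1 pact_cat /= cats0. Qed.

Lemma eq_pact l l' w :
  (forall u, (size u < size w)%N -> l u = l' u) -> pact l w = pact l' w.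
Proof.
elim: w l l' => //= x w IH l l' e; rewrite e //.
by rewrite (IH _ (fun v => l' (x :: v))) // => u su; exact: e.
Qed.

Lemma pact_take l w n : take n (pact l w) = pact l (take n w).
Proof.
elim: w l n => // x w IH l [|n] //=; by rewrite IH.
Qed.

(** This form passes through [pact], which preserves length and commutes with [take]. *)
Lemma childE u v : child u v = (size v == (size u).+1) && (take (size u) v == u).
Proof.
apply/idP/andP.
  by case/orP=> /eqP ->; rewrite size_rcons -cats1 take_size_cat // !eqxx.
case=> /eqP sv /eqP tv; rewrite /child.
elim/last_ind: v sv tv => // v x _; rewrite size_rcons => -[sv].
by rewrite -cats1 take_cat sv ltnn subnn take0 cats0 => ->; rewrite cats1;
  case: x; rewrite eqxx ?orbT.
Qed.

Lemma childP u v : reflect (exists x, v = rcons u x) (child u v).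
Proof.
apply: (iffP orP) => [[]/eqP->|[[] ->]]; [by exists false| by exists true| |];
  by [right|left].
Qed.

Lemma child_pact l u v : child (pact l u) (pact l v) = child u v.
Proof. by rewrite !childE !size_pact pact_take (inj_eq (@pact_inj l)). Qed.

Lemma adjacent_pact l u v :
  Defs.adjacent (pact l u) (pact l v) = Defs.adjacent u v.
Proof. by rewrite /Defs.adjacent !child_pact. Qed.

Lemma label_eq_pact (f : seq bool -> seq bool) l w :
  f w = pact l w -> (forall x, f (rcons w x) = pact l (rcons w x)) ->
  label f w = l w.
Proof.
move=> fw fwx; rewrite /label /section_at !cats1 !fwx fw size_pact.
rewrite !pact_rcons -!cats1 !drop_size_cat ?size_pact //.
by case: (l w).
Qed.

Lemma label_pact l : label (pact l) =1 l.
Proof. by move=> w; exact: label_eq_pact. Qed.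

(** The two children of [w] go to distinct children of [f w], so their last letters are both kept or
    both exchanged, which is what the label records. The bound [n] lets one proof serve both the
    infinite and the finite tree. *)
Lemma pact_label (f : seq bool -> seq bool) n :
  f [::] = [::] ->
  (forall u x, (size u < n)%N -> child (f u) (f (rcons u x))) ->
  (forall u, (size u < n)%N -> f (rcons u false) != f (rcons u true)) ->
  forall w, (size w <= n)%N -> f w = pact (label f) w.
Proof.
move=> f0 fc fi; elim/last_ind => // w x IH; rewrite size_rcons => sw.
rewrite pact_rcons -IH; last exact: ltnW.
have /childP[y0 e0] := fc w false sw; have /childP[y1 e1] := fc w true sw.
have := fi _ sw; rewrite /label /section_at !cats1 e0 e1.
rewrite -!cats1 !drop_size_cat // !cats1.
have -> : f (rcons w x) = rcons (f w) (if x then y1 else y0) by case: x.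
case: (y0); case: (y1); case: (x); rewrite ?eqxx //.
Qed.

Lemma pact_false w : pact (fun=> false) w = w.
Proof. by elim: w => //= x w ->. Qed.

Lemma pact_comp l l' w :
  pact l' (pact l w) = pact (fun u => l u (+) l' (pact l u)) w.
Proof.
elim: w l l' => //= x w IH l l'; rewrite IH; congr cons.
by rewrite addbA [l' _ (+) _]addbC.
Qed.

Lemma treeAut_pact (g : treeAut) : g =1 pact (label g).
Proof.
move=> w; apply: (@pact_label _ (size w)) => //.
- by have [_ r _] := treeAutP g; exact: (r [::]).
- by move=> u x _; exact: treeAut_child.
- move=> u _; have [bg _ _] := treeAutP g.
  by rewrite (inj_eq (bij_inj bg)) -!cats1 eqseq_cat // eqxx.
Qed.

Lemma treeAut_label_inj (g h : treeAut) : label g =1 label h -> g = h.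
Proof.
move=> e; apply: treeAut_eq => w; rewrite !treeAut_pact.
by apply: eq_pact => u _; exact: e.
Qed.

Lemma rooted_aut_pact l : rooted_aut id (pact l).
Proof.
split; first by exists (pact_inv l); [exact: pactK|exact: pact_invK].
- by move=> t ->.
- exact: adjacent_pact.
Qed.

Definition portraitAut l : treeAut := TreeAut (rooted_aut_pact l).

Lemma label_portraitAut l : label (portraitAut l) =1 l.
Proof. exact: label_pact. Qed.


(** * The finite groups $G(d)$ in terms of labels *)

Section FiniteTree.
Variable d : nat.
Implicit Types (g h : {perm d.-bseq bool}).

Lemma val_insub_bseq w : (size w <= d)%N -> insub_bseq d w = w :> seq bool.
Proof. by move=> sw; rewrite /insub_bseq insubdK. Qed.

Definition pact_bseq l (t : d.-bseq bool) : d.-bseq bool :=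
  insub_bseq d (pact l t).

Lemma pact_bseqE l t : pact_bseq l t = pact l t :> seq bool.
Proof. by rewrite val_insub_bseq // size_pact size_bseq. Qed.

Lemma pact_bseq_inj l : injective (pact_bseq l).
Proof.
move=> s t /(congr1 (@bseqval d bool)); rewrite !pact_bseqE => /pact_inj.
exact: val_inj.
Qed.

Definition portrait_perm l : {perm d.-bseq bool} := perm (@pact_bseq_inj l).

Lemma word_act_portrait l w :
  (size w <= d)%N -> word_act (portrait_perm l) w = pact l w.
Proof. by move=> sw; rewrite /word_act permE pact_bseqE val_insub_bseq. Qed.

Lemma label_portrait l w :
  (size w < d)%N -> label (word_act (portrait_perm l)) w = l w.
Proof.
move=> sw; apply: label_eq_pact => [|x]; apply: word_act_portrait.
  exact: ltnW.
by rewrite size_rcons.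
Qed.

Lemma portrait_in_finAut l : portrait_perm l \in finAut d.
Proof.
rewrite finset.inE; apply/asboolP; split.
- by exists (fun_of_perm (portrait_perm l)^-1%g); [exact: permK|exact: permKV].
- by move=> t t0; rewrite permE pact_bseqE t0.
- by move=> t u; rewrite !permE !pact_bseqE adjacent_pact.
Qed.

Lemma word_actE g w : g \in finAut d -> (size w <= d)%N ->
  word_act g w = pact (label (word_act g)) w.
Proof.
rewrite finset.inE => /asboolP[bg rg ag].
have wE u : word_act g u = bseqval (g (insub_bseq d u)) by [].
have gi u v : (size u <= d)%N -> (size v <= d)%N -> word_act g u = word_act g v -> u = v.
  move=> su sv; rewrite !wE => /val_inj/perm_inj/(congr1 (@bseqval d bool)).
  by rewrite /= !val_insub_bseq.
have g0 : word_act g [::] = [::] by apply: rg; rewrite val_insub_bseq.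
apply: pact_label => //.
  have adj u x : (size u < d)%N ->
      Defs.adjacent (word_act g u) (word_act g (rcons u x)).
    move=> su; rewrite !wE ag !val_insub_bseq ?size_rcons //; last exact: ltnW.
    by rewrite /Defs.adjacent; apply/orP; left; apply/childP; exists x.
  elim/last_ind => [|u z IHu] x su.
    have := adj [::] x su; rewrite g0 => /orP[//|/childP[y /(congr1 size)]].
    by rewrite size_rcons.
  rewrite size_rcons in su.
  (* Were the image of the child the parent of the image of [rcons u z], it would equal the image of
     [u], against injectivity. *)
  have := adj (rcons u z) x; rewrite size_rcons => /(_ su)/orP[//|/childP[y Ey]].
  have /childP[y' Ey'] := IHu z (ltnW su).
  move: Ey; rewrite Ey' => /rcons_inj[/gi Eu _].
  move: Eu; rewrite !size_rcons => /(_ (ltnW (ltnW su)) su)/(congr1 size).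
  by rewrite !size_rcons => /eqP; rewrite ltn_eqF //.
move=> u su; apply/eqP => /gi; rewrite !size_rcons => /(_ su su).
by move=> /rcons_inj[].
Qed.

Lemma size_word_act g w : g \in finAut d -> (size w <= d)%N ->
  size (word_act g w) = size w.
Proof. by move=> gG sw; rewrite word_actE // size_pact. Qed.

Lemma finAut_eq g h : g \in finAut d -> h \in finAut d ->
  (forall w, (size w < d)%N -> label (word_act g) w = label (word_act h) w) ->
  g = h.
Proof.
move=> gG hG e; apply/permP => t; apply: val_inj => /=.
have wE k : bseqval (fun_of_perm k t) = word_act k t.
  by rewrite /word_act /insub_bseq valKd.
rewrite !wE !word_actE ?size_bseq //; apply: eq_pact => u su.
by apply: e; exact: leq_trans su (size_bseq t).
Qed.

Lemma word_actM g h w : word_act (g * h)%g w = word_act h (word_act g w).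
Proof. by rewrite /word_act permM /insub_bseq valKd. Qed.

(** The product applies [g] first, so the label of [h] is read at the image of [w]. *)
Lemma label_mul g h w : g \in finAut d -> h \in finAut d -> (size w < d)%N ->
  label (word_act (g * h)%g) w =
  label (word_act g) w (+) label (word_act h) (word_act g w).
Proof.
move=> gG hG sw; rewrite [in RHS]word_actE // 1?ltnW //.
apply: (@label_eq_pact _ (fun u => label (word_act g) u (+)
  label (word_act h) (pact (label (word_act g)) u))) => [|x].
  by rewrite word_actM !word_actE ?pact_comp ?size_pact // ltnW.
by rewrite word_actM !word_actE ?pact_comp ?size_pact ?size_rcons.
Qed.

Lemma word_act_id g w : g \in finAut d -> (size w <= d)%N ->
  (forall u, (size u < size w)%N -> label (word_act g) u = false) ->
  word_act g w = w.
Proof.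
by move=> gG sw g0; rewrite word_actE // (eq_pact g0) pact_false.
Qed.

End FiniteTree.

(** * Characters of the finite groups *)

(** The sum in $C_2$ of a row of labels, split at the first letter so that it follows the recursion
    of [pact]. *)
Fixpoint parity (k : nat) (f : seq bool -> bool) : bool :=
  if k is k'.+1 then
    parity k' (fun w => f (false :: w)) (+) parity k' (fun w => f (true :: w))
  else f [::].

Lemma eq_parity k f f' : (forall w, size w = k -> f w = f' w) ->
  parity k f = parity k f'.
Proof.
elim: k f f' => [|k IH] f f' e /=; first exact: e.
by congr addb; apply: IH => w sw; apply: e => /=; rewrite sw.
Qed.

Lemma parityD k f f' :
  parity k (fun w => f w (+) f' w) = parity k f (+) parity k f'.
Proof. by elim: k f f' => //= k IH f f'; rewrite !IH addbACA. Qed.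

(** Automorphisms permute each level; in the recursion, a root label only exchanges the two half
    sums. *)
Lemma parity_pact k l f : parity k (fun w => f (pact l w)) = parity k f.
Proof.
elim: k l f => //= k IH l f.
rewrite (IH _ (fun v => f ((l [::] (+) false) :: v))).
rewrite (IH _ (fun v => f ((l [::] (+) true) :: v))).
by case: (l [::]) => //=; rewrite addbC.
Qed.

Lemma parity_false k : parity k (fun=> false) = false.
Proof. by elim: k => //= k ->. Qed.

Lemma parity_pred1 k w : size w = k -> parity k (pred1 w) = true.
Proof.
elim: k w => [|k IH] [] //= x w [sw].
have E y : parity k (fun v => (y :: v == x :: w)) = (y == x).
  case: (eqVneq y x) => [->|ne].
    by rewrite -[RHS](IH w sw); apply: eq_parity => v _; rewrite eqseq_cons eqxx.
  rewrite -[RHS](parity_false k); apply: eq_parity => v _.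
  by rewrite eqseq_cons (negPf ne).
by rewrite !E; case: x {E}.
Qed.

(** A row is the sum of its indicators, which all have value [c]. The induction splits the row into
    the halves below the two children of the root. *)
Lemma additive_parity k (chi : (seq bool -> bool) -> bool) (c : bool) :
  (forall r r', (forall w, size w = k -> r w = r' w) -> chi r = chi r') ->
  (forall r r', chi (fun w => r w (+) r' w) = chi r (+) chi r') ->
  (forall w, size w = k -> chi (pred1 w) = c) ->
  forall r, chi r = c && parity k r.
Proof.
have chi0 (phi : (seq bool -> bool) -> bool) :
    (forall r r', phi (fun w => r w (+) r' w) = phi r (+) phi r') ->
    phi (fun=> false) = false.
  by move=> H; rewrite -[LHS]/(phi (fun=> false (+) false)) H addbb.
elim: k chi => [|k IH] chi ext add del r /=.
  have := del [::] erefl; case: (boolP (r [::])) => r0 <-.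
    by rewrite andbT; apply: ext => -[|//] _ /=; rewrite r0.
  by rewrite andbF -[RHS](chi0 _ add); apply: ext => -[|//] _; exact: negbTE.
pose put x r' w := if w is y :: w' then (y == x) && r' w' else false.
have half x r' : chi (put x r') = c && parity k r'.
  apply: (IH (fun r0 => chi (put x r0))) => {r r'} [r r' e|r r'|w sw].
  - by apply: ext => -[//|y w] /= [sw]; rewrite e.
  - rewrite -add; apply: ext => -[//|y w] _ /=; by case: (y == x).
  - rewrite -(del (x :: w)); last by rewrite /= sw.
    by apply: ext => -[//|y v] _ /=; rewrite eqseq_cons.
rewrite andb_addr -(half false) -(half true) -add; apply: ext => -[//|[] w] _ //=.
by rewrite addbF.
Qed.

(** These labels depend on the level only: a whole level is flipped where the two words differ. This
    gives transitivity on levels. *)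
Lemma pact_mover w w0 : size w = size w0 ->
  pact (fun u => nth false w (size u) (+) nth false w0 (size u)) w = w0.
Proof.
elim: w w0 => [|x w IH] [|x0 w0] //= [sw].
by rewrite IH // addbAC addbb.
Qed.

Section Patterns.
Variable e : nat.
Local Notation d := e.+1.
Local Notation G := (finAut d).
Implicit Types (g h : {perm d.-bseq bool}).
Local Notation lab g := (label (word_act g)).

Definition row_aut k r : {perm d.-bseq bool} :=
  portrait_perm d (fun w => (size w == k) && r w).

Lemma row_aut_in k r : row_aut k r \in G.
Proof. exact: portrait_in_finAut. Qed.

Lemma label_row k r w : (size w < d)%N ->
  lab (row_aut k r) w = (size w == k) && r w.
Proof. exact: label_portrait. Qed.

Lemma row_aut_id k r w : (size w <= k)%N -> (k < d)%N ->
  word_act (row_aut k r) w = w.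
Proof.
move=> sw kd; have wd := leq_ltn_trans sw kd.
apply: word_act_id; [exact: row_aut_in|exact: ltnW|].
move=> u su; rewrite label_row ?(ltn_trans su) //.
by rewrite ltn_eqF // (leq_trans su).
Qed.

Lemma eq_row_aut k r r' : (forall w, size w = k -> r w = r' w) ->
  row_aut k r = row_aut k r'.
Proof.
move=> E; apply: finAut_eq; rewrite ?row_aut_in // => w sw.
by rewrite !label_row //; case: eqP => // /E ->.
Qed.

Lemma label_row_mul k r g w : g \in G -> (k < d)%N -> (size w <= k)%N ->
  lab (row_aut k r * g)%g w = ((size w == k) && r w) (+) lab g w.
Proof.
move=> gG kd sw; have wd := leq_ltn_trans sw kd.
by rewrite label_mul ?row_aut_in // label_row // row_aut_id.
Qed.

Lemma row_autM k r r' : (k < d)%N ->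
  (row_aut k r * row_aut k r')%g = row_aut k (fun w => r w (+) r' w).
Proof.
move=> kd; apply: finAut_eq; rewrite ?groupM ?row_aut_in // => w sw.
have sw' := size_word_act (row_aut_in k r) (ltnW sw).
rewrite label_mul ?row_aut_in // !label_row ?sw' //.
by case: eqP => // wk; rewrite row_aut_id // wk.
Qed.

Lemma row_aut0 k : row_aut k (fun=> false) = 1%g.
Proof.
apply: finAut_eq; rewrite ?group1 ?row_aut_in // => w sw.
rewrite label_row // andbF; apply/esym/label_eq_pact => [|x];
  rewrite pact_false /word_act perm1 val_insub_bseq // ?size_rcons //.
exact: ltnW.
Qed.

(** Conjugation by [g] permutes the row. Labels of [g] below level [k] have to vanish, because
    [row_aut] moves the vertices at which they are read. *)
Lemma row_conj k g r : g \in G -> (k < d)%N ->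
  (forall w, (k < size w < d)%N -> lab g w = false) ->
  (row_aut k (fun w => r (word_act g w)) * g = g * row_aut k r)%g.
Proof.
move=> gG kd g0; apply: finAut_eq; rewrite ?groupM ?row_aut_in // => w sw.
have sg := size_word_act gG (ltnW sw).
rewrite !label_mul ?row_aut_in // !label_row ?sg // addbC; congr addb.
have [wk|kw] := leqP (size w) k; first by rewrite row_aut_id.
by rewrite !g0 ?size_word_act ?row_aut_in ?kw ?(ltnW sw).
Qed.

Definition bool_char (chi : {perm d.-bseq bool} -> bool) : Prop :=
  {in G &, forall g h, chi (g * h)%g = chi g (+) chi h}.

(** Elements supported on one level generate $G(d)$: the topmost remaining row of labels is removed
    by left multiplication. Here [n] counts the bottom levels that may still carry labels. *)
Lemma bool_char_trivial chi : bool_char chi ->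
  (forall k r, (k < d)%N -> chi (row_aut k r) = false) ->
  {in G, forall g, chi g = false}.
Proof.
move=> chiM chi0.
suff H n g : g \in G -> (n <= d)%N ->
    (forall w, (size w < d - n)%N -> lab g w = false) -> chi g = false.
  by move=> g gG; apply: (H d g) => // w; rewrite subnn.
elim: n g => [|n IH] g gG nd g0.
  have -> : g = 1%g.
    rewrite -(row_aut0 0); apply: finAut_eq; rewrite ?row_aut_in // => w sw.
    by rewrite g0 ?subn0 // label_row // andbF.
  by rewrite -(row_aut0 0) chi0.
set k := (d - n.+1)%N in g0; have kd : (k < d)%N by rewrite /k; lia.
have := chiM _ _ (row_aut_in k (lab g)) gG.
rewrite chi0 //= => <-; apply: IH; [by rewrite groupM ?row_aut_in|exact: ltnW|].
move=> w sw; have wk : (size w <= k)%N by rewrite /k; lia.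
rewrite label_row_mul //; case: eqP => [//|/eqP ne].
  by rewrite /= addbb.
by rewrite g0 // ltn_neqAle ne.
Qed.

Definition level_char (c : nat -> bool) g : bool :=
  \big[addb/false]_(k < d) (c k && parity k (lab g)).

Lemma parity_mul k : (k < d)%N -> bool_char (fun g => parity k (lab g)).
Proof.
move=> kd g h gG hG; rewrite -[parity k (lab h)](parity_pact k (lab g)) -parityD.
apply: eq_parity => w sw; rewrite label_mul ?sw // -word_actE // sw; exact: ltnW.
Qed.

Lemma level_charM c : bool_char (level_char c).
Proof.
move=> g h gG hG; rewrite /level_char -big_split /=; apply: eq_bigr => k _.
by rewrite parity_mul // andb_addr.
Qed.

Lemma level_char_row c k r : (k < d)%N ->
  level_char c (row_aut k r) = c k && parity k r.
Proof.
move=> kd; rewrite /level_char (bigD1 (Ordinal kd)) //= big1 ?addbF.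
  congr andb; apply: eq_parity => w sw; by rewrite label_row ?sw // eqxx.
move=> i ne; rewrite (@eq_parity _ _ (fun=> false)) ?parity_false ?andbF //.
by move=> w sw; rewrite label_row ?sw // -[X in _ == X]/(val (Ordinal kd)) (inj_eq val_inj) (negPf ne).
Qed.

(** The difference of both sides is a character, so it suffices to compare them on single rows,
    where [additive_parity] applies once all indicators of a level are seen to be conjugate. *)
Lemma bool_charE chi : bool_char chi ->
  {in G, chi =1 level_char (fun k => chi (row_aut k (pred1 (nseq k false))))}.
Proof.
move=> chiM; pose c k := chi (row_aut k (pred1 (nseq k false))).
suff H : {in G, forall g, chi g (+) level_char c g = false}.
  by move=> g /H; case: (chi g) (level_char c g) => [] [].
apply: bool_char_trivial => [g h gG hG|k r kd].
  by rewrite chiM // level_charM // addbACA.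
rewrite level_char_row // -(@additive_parity k (fun r => chi (row_aut k r)) (c k)) ?addbb //.
- by move=> r1 r2 E; rewrite (eq_row_aut E).
- by move=> r1 r2; rewrite -row_autM // chiM ?row_aut_in.
- move=> w sw; set w0 := nseq k false.
  (* This element carries [w] to [w0]. As [nth] returns [false] past the end, it has no labels from
     level [k] on, as [row_conj] requires. *)
  pose g := portrait_perm d (fun u => nth false w (size u) (+) nth false w0 (size u)).
  have gG : g \in G by exact: portrait_in_finAut.
  have gw : word_act g w = w0.
    by rewrite word_act_portrait ?pact_mover ?size_nseq // sw ltnW.
  have := @row_conj k g (pred1 w0) gG kd.
  rewrite (@eq_row_aut k _ (pred1 w)); last first.
    move=> v sv /=; rewrite -gw; apply/eqP/eqP => [|->//].
    rewrite !word_actE ?sw ?sv; [exact: pact_inj| | | |] => //; exact: ltnW.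
  move=> E; have /(congr1 chi) : (row_aut k (pred1 w) * g =
      g * row_aut k (pred1 w0))%g.
    apply: E => u /andP[ku ud].
    by rewrite label_portrait // !nth_default ?size_nseq ?sw // ltnW.
  by rewrite !chiM ?row_aut_in // addbC => /addbI.
Qed.

End Patterns.

(** * Essential pattern groups with bottom rows of index two *)

Local Notation level_row n := {ffun n.-tuple bool -> bool}.

(** Rows of one level form a finite type and can be counted; words of other lengths get the default
    [false]. *)
Definition row_get n (r : level_row n) w : bool :=
  if insub w is Some t then r t else false.

Definition row_mk n f : level_row n := [ffun t => f (tval t)].

Lemma row_mkK n f w : size w = n -> row_get (row_mk n f) w = f w.
Proof.
move=> sw; rewrite /row_get; case: insubP => [t _ <-|]; first by rewrite ffunE.
by rewrite sw eqxx.
Qed.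

Lemma row_getK n (r : level_row n) : row_mk n (row_get r) = r.
Proof. by apply/ffunP => t; rewrite ffunE /row_get valK. Qed.

Lemma eq_row_mk n f f' : (forall w, size w = n -> f w = f' w) ->
  row_mk n f = row_mk n f'.
Proof. by move=> E; apply/ffunP => t; rewrite !ffunE E // size_tuple. Qed.

Lemma card_level_row n : #|{: level_row n}| = (2 ^ 2 ^ n)%N.
Proof. by rewrite card_ffun card_tuple card_bool. Qed.

Section Groups.
Variable e : nat.
Local Notation d := e.+1.
Local Notation G := (finAut d).
Implicit Types (g h : {perm d.-bseq bool}) (P : {group {perm d.-bseq bool}}).
Local Notation lab g := (label (word_act g)).

Definition bottom_rows P : {set level_row e} :=
  [set r : level_row e | row_aut e e (row_get r) \in P]%SET.

Lemma row_aut_get r : row_aut e e (row_get (row_mk e r)) = row_aut e e r.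
Proof. by apply: eq_row_aut => w sw; rewrite row_mkK. Qed.

Lemma mem_bottom_rows P r :
  (row_mk e r \in bottom_rows P) = (row_aut e e r \in P).
Proof. by rewrite finset.inE row_aut_get. Qed.

Definition row_shift f (r : level_row e) : level_row e :=
  row_mk e (fun w => f w (+) row_get r w).

Lemma row_shiftK f : involutive (row_shift f).
Proof.
move=> r; rewrite -[RHS]row_getK; apply: eq_row_mk => w sw.
by rewrite row_mkK // addbA addbb.
Qed.

(** The shift is an involution that exchanges [A] with its complement. *)
Lemma card_half (A : {set level_row e}) f :
  (forall r : level_row e, (row_shift f r \in A) = (r \notin A)) ->
  (#|A| * 2 = 2 ^ 2 ^ e)%N.
Proof.
move=> H; rewrite -card_level_row -(finset.cardsC A) muln2 -addnn; congr addn.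
rewrite -[LHS](card_preimset A (inv_inj (row_shiftK f))).
by apply: eq_card => r; rewrite !finset.inE H.
Qed.

(** For [r] outside [P], translation by [r] exchanges the rows in [P] with the others: one inclusion
    is the group law, equality follows by counting. *)
Lemma bottom_rows_index2 P : (#|bottom_rows P| * 2 = 2 ^ 2 ^ e)%N ->
  {morph (fun r => row_aut e e r \notin P) :
     r r' / (fun w => r w (+) r' w) >-> r (+) r'}.
Proof.
move=> cP r r' /=; have [rP|rP] := boolP (row_aut e e r \in P).
  by rewrite -row_autM // groupMl.
set B := bottom_rows P in cP.
have dB : row_shift r @^-1: B = (~: B)%SET.
  apply/eqP; rewrite eqEcard; apply/andP; split.
    apply/fintype.subsetP => x; rewrite finset.inE finset.in_setC mem_bottom_rows.
    rewrite [x \in B]finset.inE => rxP; apply: contra rP => xP.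
    have := groupM rxP xP; rewrite row_autM // (@eq_row_aut e e _ r) // => w _.
    by rewrite -addbA addbb addbF.
  rewrite card_preimset; last exact: inv_inj (row_shiftK r).
  by have := finset.cardsC B; rewrite card_level_row -cP muln2 -addnn => /addnI ->.
have := congr1 (fun A : {set _} => row_mk e r' \in A) dB.
rewrite finset.inE finset.in_setC !mem_bottom_rows => E; rewrite -E /=.
suff -> : row_aut e e (fun w => r w (+) row_get (row_mk e r') w) =
  row_aut e e (fun w => r w (+) r' w) by [].
by apply: eq_row_aut => w sw; rewrite row_mkK.
Qed.

Lemma bottom_rows_proper P : (#|bottom_rows P| * 2 = 2 ^ 2 ^ e)%N ->
  exists r, row_aut e e r \notin P.
Proof.
move=> cP; apply/not_existsP => H.
have : bottom_rows P = [set: level_row e]%SET.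
  by apply/finset.setP => r; rewrite !finset.inE; apply/negPn/negP; exact: H.
move=> E; move: cP; rewrite E cardsT card_level_row.
have := expn_gt0 2 (2 ^ e); lia.
Qed.

Section Essential.
Variable P : {group {perm d.-bseq bool}}.
Hypotheses (PG : pattern_group P) (Pess : essential P) (e0 : (0 < e)%N).
Hypothesis cP : (#|bottom_rows P| * 2 = 2 ^ 2 ^ e)%N.

Let PGm g : g \in P -> g \in G.
Proof. by move/(fintype.subsetP PG). Qed.

Definition put x r w := if w is y :: w' then (y == x) && r w' else false.

(* If some row below one child is missing from [P], correcting by it makes
   every row below the other child available. *)
Lemma second_row_full r : exists2 g, g \in P &
  forall w, (size w < e)%N -> lab g w = (size w == e.-1) && r w.
Proof.
have [x [b bP bx]] : exists x, exists2 b, row_aut e e b \in P &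
    forall w, b (x :: w) = r w.
  have [H|H] := pselect (row_aut e e (put false r) \in P).
    by exists false, (put false r).
  have [H'|/negP H'] := pselect (row_aut e e (put true r) \in P).
    by exists true, (put true r).
  exists true, (fun w => put false r w (+) put true r w) => [|w] //=.
  have /negP Hn := H.
  by apply/negPn; rewrite (bottom_rows_index2 cP) Hn H'.
have [h hP hE] := Pess x bP.
exists h => // w sw; rewrite hE //= label_row //= bx.
by rewrite -[in RHS]eqSS (prednK e0).
Qed.

(** Descending induction from level [e.-1]: the section at [false] of an element with row
    [put false r] on level [k.+1] has row [r] on level [k]. Labels below level [k] are left
    uncontrolled. *)
Lemma level_full k : (k < e)%N -> forall r, exists2 g, g \in P &
  forall w, (size w <= k)%N -> lab g w = (size w == k) && r w.
Proof.
move=> ke; have [n kn] : exists n, (k + n = e.-1)%N by exists (e.-1 - k)%N; lia.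
elim: n k kn ke => [|n IH] k kn ke r.
  have [g gP gE] := second_row_full r; exists g => // w sw.
  by rewrite gE ?(leq_ltn_trans sw) // -kn addn0.
have [||g gP gE] := IH k.+1 _ _ (put false r); [lia|lia|].
have [h hP hE] := Pess false gP; exists h => // w sw.
rewrite hE; last by move: ke sw; lia.
by rewrite gE.
Qed.

(** Labels are adjusted from the top down. The corrector from [level_full] is trivial above level
    [k], so it does not disturb the labels already obtained. *)
Lemma essential_full f : exists2 g, g \in P &
  forall w, (size w < e)%N -> lab g w = f w.
Proof.
suff H k : (k <= e)%N -> exists2 g, g \in P &
  forall w, (size w < k)%N -> lab g w = f w by exact: H.
elim: k => [|k IH] ke; first by exists 1%g.
have [g gP gE] := IH (ltnW ke).
have [h hP hE] := level_full ke (fun w => f w (+) lab g w).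
exists (h * g)%g => [|w sw]; first exact: groupM.
have h0 u : (size u < size w)%N -> lab h u = false.
  move=> su; have uk : (size u < k)%N by exact: leq_trans su sw.
  by rewrite hE ?(ltn_eqF uk) // ltnW.
have wd : (size w < d)%N by rewrite (leq_trans sw) // ltnW.
rewrite label_mul ?PGm // word_act_id ?PGm //; last exact: ltnW.
rewrite hE //; case: eqP => [_|/eqP ne]; first by rewrite -addbA addbb addbF.
by rewrite gE // ltn_neqAle ne.
Qed.

Lemma row_conj_mem g r : g \in P ->
  (row_aut e e (fun w => r (word_act g w)) \in P) = (row_aut e e r \in P).
Proof.
move=> gP; rewrite -(groupMr _ gP) row_conj ?PGm //.
  by rewrite groupMl.
by move=> w; rewrite ltnS => /andP[a b]; move: (leq_trans a b); rewrite ltnn.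
Qed.

(** Some element of [P] has the labels of [pact_mover] above level [e], so it carries [w] to [w']
    and conjugates one indicator row into the other. *)
Lemma row_pred1_mem w w' : size w = e -> size w' = e ->
  (row_aut e e (pred1 w) \in P) = (row_aut e e (pred1 w') \in P).
Proof.
move=> sw sw'.
have [g gP gE] :=
  essential_full (fun u => nth false w (size u) (+) nth false w' (size u)).
have gw : word_act g w = w'.
  rewrite word_actE ?PGm ?sw // -[RHS](@pact_mover w) ?sw //.
  by apply: eq_pact => u su; rewrite gE // -sw.
rewrite -(row_conj_mem (pred1 w') gP).
rewrite (@eq_row_aut e e (pred1 w) (fun v => pred1 w' (word_act g v))) // => v sv.
rewrite /= -gw; apply/eqP/eqP => [->//|].
by rewrite !word_actE ?PGm ?sw ?sv //; exact: pact_inj.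
Qed.

(** Non-membership is additive and constant on indicators, hence a multiple of the parity; the
    factor is not zero since some row is missing from [P]. *)
Lemma row_mem r : (row_aut e e r \in P) = ~~ parity e r.
Proof.
have rowE c : (row_aut e e (pred1 (nseq e false)) \notin P) = c ->
    forall r', (row_aut e e r' \notin P) = c && parity e r'.
  move=> cE; apply: (additive_parity (chi := fun r => row_aut e e r \notin P)).
  - by move=> r1 r2 /eq_row_aut ->.
  - exact: (bottom_rows_index2 cP).
  - by move=> w sw; rewrite -cE (row_pred1_mem sw (size_nseq e false)).
rewrite -[LHS]negbK; case: (boolP (row_aut e e (pred1 (nseq e false)) \in P)).
  move=> /negbF/rowE H; have [r0] := bottom_rows_proper cP.
  by rewrite H.
by move=> /rowE ->.
Qed.

Lemma row_decomp g : g \in G ->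
  exists r, exists2 h, h \in P & g = (row_aut e e r * h)%g.
Proof.
move=> gG; have [h hP hE] := essential_full (lab g).
exists (fun w => lab g w (+) lab h w), h => //.
apply: finAut_eq; rewrite ?groupM ?row_aut_in ?(PGm hP) // => w sw.
rewrite label_row_mul ?(PGm hP) //; case: eqP => [_|/eqP ne].
  by rewrite -addbA addbb addbF.
by rewrite hE // ltn_neqAle ne.
Qed.

(** Both arguments are written as a bottom row times an element of [P]. Moving the second row across
    the first element of [P] permutes it, which keeps its parity. *)
Lemma notin_char : bool_char (fun g => g \notin P).
Proof.
move=> _ _ /row_decomp[r [g gP ->]] /row_decomp[r' [g' g'P ->]].
rewrite -mulgA [(g * (_ * _))%g]mulgA.
have := @row_conj e e g r'; rewrite PGm // => <- //; last first.
  by move=> w; rewrite ltnS => /andP[a b]; move: (leq_trans a b); rewrite ltnn.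
rewrite !mulgA row_autM // -!mulgA !groupMr ?groupM // !row_mem negbK parityD.
rewrite negbK; congr addb.
rewrite -(parity_pact e (lab g) r') negbK; apply: eq_parity => w sw.
by rewrite word_actE ?PGm // sw.
Qed.

Lemma essential_kernel : P = [set g in G | ~~ level_char
  (fun k => row_aut e k (pred1 (nseq k false)) \notin P) g]%SET :> {set _}.
Proof.
apply/finset.setP => g; rewrite finset.inE; case: (boolP (g \in G)) => [gG|gG] /=.
  by rewrite -(bool_charE notin_char gG) negbK.
by apply/negP => /PGm; rewrite (negPf gG).
Qed.

End Essential.

(** * Kernels of level characters *)

Definition level_ker (c : nat -> bool) : {set {perm d.-bseq bool}} :=
  [set g in G | ~~ level_char c g]%SET.

Lemma in_level_ker c g : (g \in level_ker c) = (g \in G) && ~~ level_char c g.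
Proof. by rewrite finset.inE. Qed.

Lemma level_ker_group_set c : group_set (level_ker c).
Proof.
apply/group_setP; split=> [|g h].
  rewrite in_level_ker group1 -(row_aut0 e 0) level_char_row //.
  by rewrite parity_false andbF.
rewrite !in_level_ker => /andP[gG cg] /andP[hG ch].
by rewrite groupM // level_charM // (negPf cg) (negPf ch).
Qed.

Canonical level_ker_group c := Group (level_ker_group_set c).

Lemma level_ker_pattern c : pattern_group (level_ker_group c).
Proof. by apply/fintype.subsetP => g; rewrite in_level_ker => /andP[]. Qed.

Lemma bottom_rows_level_ker (c : nat -> bool) : c e ->
  (#|bottom_rows (level_ker_group c)| * 2 = 2 ^ 2 ^ e)%N.
Proof.
move=> ce; apply: (@card_half _ (pred1 (nseq e false))) => r.
rewrite mem_bottom_rows [r \in _]finset.inE !in_level_ker !row_aut_in !level_char_row // ce /=.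
by rewrite parityD parity_pred1 ?size_nseq // negbK.
Qed.

Lemma level_ker_essential (c : nat -> bool) : c e -> essential (level_ker_group c).
Proof.
move=> ce g i; rewrite in_level_ker => /andP[gG cg].
pose h0 := portrait_perm d (fun w => (size w < e)%N && lab g (i :: w)).
have h0G : h0 \in G by exact: portrait_in_finAut.
(* The section [h0] is prescribed above level [e] only, so one label on level [e] is free to cancel
   its character value. *)
pose s := fun w => level_char c h0 && (w == nseq e false).
exists (row_aut e e s * h0)%g.
  rewrite in_level_ker groupM ?row_aut_in //= level_charM ?row_aut_in //.
  rewrite level_char_row // ce /s /=; case: (level_char c h0) => /=.
    by rewrite parity_pred1 ?size_nseq.
  by rewrite parity_false.
move=> w sw; rewrite label_row_mul //; last exact: ltnW.
by rewrite ltn_eqF //= label_portrait ?sw // ltnW.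
Qed.

(** Index two: if an overgroup contains some [h] outside the kernel, then for every [x] in $G(d)$
    either [x] or [x * h] lies in the kernel, so the overgroup is everything. *)
Lemma level_ker_maximal (c : nat -> bool) : c e -> maximal (level_ker_group c) G.
Proof.
move=> ce; apply/maxgroupP; split.
  rewrite properE level_ker_pattern /=; apply/fintype.subsetPn.
  exists (row_aut e e (pred1 (nseq e false))); first exact: row_aut_in.
  by rewrite in_level_ker row_aut_in level_char_row // ce parity_pred1 ?size_nseq.
move=> H /fintype.properP[HG [x xG xH]] KH; apply/eqP; rewrite finset.eqEsubset KH andbT.
apply/fintype.subsetP => h hH; have hG := fintype.subsetP HG _ hH.
rewrite in_level_ker hG; apply/negP => ch; move/negP: xH; apply.
have [cx|cx] := boolP (level_char c x); last first.
  by apply: (fintype.subsetP KH); rewrite in_level_ker xG.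
rewrite -(groupMr _ hH); apply: (fintype.subsetP KH).
by rewrite in_level_ker groupM // level_charM // cx ch.
Qed.

(** The coefficient of level [e] is forced to be [true]; the [e] levels above are free, which gives
    the count $2^e$. *)
Definition extend_top (c : {ffun 'I_e -> bool}) (k : nat) : bool :=
  if insub k is Some i then c i else true.

Lemma extend_top_e c : extend_top c e.
Proof. by rewrite /extend_top insubF // ltnn. Qed.

Lemma level_ker_inj : injective (fun c => level_ker_group (extend_top c)).
Proof.
move=> c c' /(congr1 val)/= E; apply/ffunP => i.
have ie := ltn_ord i; have id' : (i < d)%N by exact: ltnW.
have cE (a : {ffun 'I_e -> bool}) : a i = extend_top a i by rewrite /extend_top valK.
rewrite !cE; set b := extend_top c i.
(* Level [e] occurs in every character considered, so the value on this element is
   [extend_top a i (+) b], which detects the coefficient at [i]. *)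
pose g := (row_aut e i (pred1 (nseq i false)) *
           row_aut e e (fun w => b && (w == nseq e false)))%g.
have gE a : (g \in level_ker (extend_top a)) = ~~ (extend_top a i (+) b).
  rewrite in_level_ker groupM ?row_aut_in //= level_charM ?row_aut_in //.
  rewrite !level_char_row // extend_top_e parity_pred1 ?size_nseq // andbT.
  congr (~~ (_ (+) _)); case: (b) => /=; last exact: parity_false.
  by rewrite parity_pred1 ?size_nseq.
by have := gE c; rewrite E gE -/b !negb_add eqxx => /eqP ->.
Qed.

Lemma essential_level_ker P : (0 < e)%N -> pattern_group P -> essential P ->
  (#|bottom_rows P| * 2 = 2 ^ 2 ^ e)%N ->
  exists c, P = level_ker_group (extend_top c).
Proof.
move=> e0 PG Pess cP.
exists [ffun k : 'I_e => row_aut e k (pred1 (nseq k false)) \notin P].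
apply: val_inj => /=; rewrite {1}(essential_kernel PG Pess e0 cP).
apply/finset.setP => g; rewrite [RHS]in_level_ker [LHS]finset.in_set; congr (_ && ~~ _).
apply: eq_bigr => k _; congr (_ && _); rewrite /extend_top.
case: insubP => [i _ ik|]; first by rewrite ffunE ik.
(* On level [e] the coefficient is [true], since an indicator row has odd parity and is therefore
   not in [P]. *)
rewrite -leqNgt => ek; have -> : k = e :> nat by have := ltn_ord k; lia.
by rewrite row_mem // parity_pred1 ?size_nseq.
Qed.

End Groups.

(** * Counting admissible portraits *)

(** Labels on the first [n] levels, as an iterated product so that an extension by one level is a
    pair. *)
Fixpoint finite_portrait (n : nat) : finType :=
  if n is n'.+1 then (finite_portrait n' * level_row n')%type else unit.

Definition glue_row n f (r : level_row n) w : bool :=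
  if size w == n then row_get r w else f w.

Fixpoint pre_get n : finite_portrait n -> seq bool -> bool :=
  if n is n'.+1 return finite_portrait n -> seq bool -> bool
  then fun t => glue_row (pre_get t.1) t.2 else fun=> xpred0.

Fixpoint pre_mk n f : finite_portrait n :=
  if n is n'.+1 return finite_portrait n then (pre_mk n' f, row_mk n' f) else tt.

Lemma pre_mkK n f w : (size w < n)%N -> pre_get (pre_mk n f) w = f w.
Proof.
elim: n => //= n IH; rewrite ltnS leq_eqVlt /glue_row.
by case: eqP => [sw _|_ /IH //]; rewrite row_mkK.
Qed.

Lemma eq_pre_mk n f f' : (forall w, (size w < n)%N -> f w = f' w) ->
  pre_mk n f = pre_mk n f'.
Proof.
elim: n => //= n IH E; congr pair; first by apply: IH => w /ltnW; exact: E.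
by apply: eq_row_mk => w sw; rewrite E // sw.
Qed.

Lemma pre_getK n (t : finite_portrait n) : pre_mk n (pre_get t) = t.
Proof.
elim: n t => [[]|n IH [t r]] //=; congr pair.
  rewrite -[RHS]IH; apply: eq_pre_mk => w sw.
  by rewrite /glue_row ltn_eqF.
by rewrite -[RHS]row_getK; apply: eq_row_mk => w sw; rewrite /glue_row sw eqxx.
Qed.

Lemma card_finite_portrait n : #|finite_portrait n| = (2 ^ (2 ^ n - 1))%N.
Proof.
elim: n => [|n IH]; first by rewrite card_unit.
rewrite card_prod IH card_level_row -expnD; congr expn.
by have := expn_gt0 2 n; rewrite expnS; lia.
Qed.

Section Admissible.
Variable e : nat.
Local Notation d := e.+1.
Local Notation G := (finAut d).
Implicit Types (g h : {perm d.-bseq bool}).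
Local Notation lab g := (label (word_act g)).
Variable P : {group {perm d.-bseq bool}}.
Hypothesis PG : pattern_group P.

Let PGm g : g \in P -> g \in G.
Proof. by move/(fintype.subsetP PG). Qed.

Lemma eq_portrait f f' : (forall w, (size w < d)%N -> f w = f' w) ->
  portrait_perm d f = portrait_perm d f'.
Proof.
move=> E; apply: finAut_eq; rewrite ?portrait_in_finAut // => w sw.
by rewrite !label_portrait // E.
Qed.

(** Only patterns that fit into the first [n] levels are tested; below height [d] there is no
    condition. *)
Definition admissible n f : bool :=
  `[< forall w, (size w + d <= n)%N -> portrait_perm d (fun v => f (w ++ v)) \in P >].

Lemma eq_admissible n f f' : (forall w, (size w < n)%N -> f w = f' w) ->
  admissible n f = admissible n f'.
Proof.
move=> E; apply: asbool_equiv_eq; split => H w sw.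
  rewrite (@eq_portrait _ (fun v => f (w ++ v))) ?H // => v sv.
  by rewrite E // size_cat; lia.
rewrite (@eq_portrait _ (fun v => f' (w ++ v))) ?H // => v sv.
by rewrite E // size_cat; lia.
Qed.

Lemma admissible_leq m n f : (m <= n)%N -> admissible n f -> admissible m f.
Proof.
move=> mn /asboolP H; apply/asboolP => w sw; apply: H; exact: leq_trans mn.
Qed.

(** The bottom rows in [P] are the intersection of [P] with the group of all bottom rows, of order
    $2^{2^e}$, so Lagrange applies. *)
Lemma card_bottom_rows :
  exists2 b, (b <= 2 ^ e)%N & #|bottom_rows P| = (2 ^ b)%N.
Proof.
pose R := [set row_aut e e (row_get r) | r in [set: level_row e]]%SET.
have Rg : group_set R.
  apply/group_setP; split=> [|_ _ /imsetP[r _ ->] /imsetP[r' _ ->]].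
    apply/imsetP; exists (row_mk e xpred0); rewrite ?finset.inE //.
    by rewrite row_aut_get row_aut0.
  apply/imsetP; exists (row_mk e (fun w => row_get r w (+) row_get r' w)).
    by rewrite finset.inE.
  by rewrite row_aut_get row_autM.
have inj : injective (fun r : level_row e => row_aut e e (row_get r)).
  move=> r r' E; rewrite -[r]row_getK -[r']row_getK; apply: eq_row_mk => w sw.
  have := congr1 (fun g => lab g w) E.
  by rewrite !label_row ?sw // eqxx.
have RB : R :&: P = [set row_aut e e (row_get r) | r in bottom_rows P]%SET.
  apply/finset.setP => g; apply/setIP/imsetP => [[/imsetP[r _ ->] gP]|[r rB ->]].
    by exists r; rewrite ?finset.inE.
  by split; [exact: imset_f|move: rB; rewrite finset.inE].
have := cardSg (subsetIl (Group Rg) P).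
rewrite /= RB !card_imset // cardsT card_level_row.
by case/dvdn_pfactor => // b be ->; exists b.
Qed.

Hypothesis Pess : essential P.
Local Notation B := #|bottom_rows P|.

(** Only patterns rooted at the $2^m$ vertices of level $m=n-e$ see the new level. Their blocks of
    level [n] are independent, and each ranges over a coset of the bottom rows in [P]. *)
Lemma card_extensions n f : (d <= n)%N -> admissible n f ->
  #|[set r : level_row n | admissible n.+1 (glue_row f r)]%SET| = (B ^ 2 ^ (n - e))%N.
Proof.
move=> dn /asboolP fadm; set m := (n - e)%N.
have mn : (m + e = n)%N by rewrite subnK // ltnW.
(* Essentiality, applied to the pattern at the parent of [w], yields an element of [P] that agrees
   with [f] below [w] as far as [f] is prescribed. *)
have hex w : exists h, size w = m -> h \in P /\
    forall v, (size v < e)%N -> lab h v = f (w ++ v).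
  case/lastP: w => [|w i]; first by exists 1%g => /= m0; lia.
  have [sw|] := pselect (size (rcons w i) = m); last by exists 1%g.
  have wP : portrait_perm d (fun v => f (w ++ v)) \in P.
    by apply: fadm; move: sw; rewrite size_rcons; lia.
  have [h hP hE] := Pess i wP; exists h => _; split=> // v sv.
  by rewrite hE // label_portrait //= cat_rcons.
have [h hP] := choice hex.
pose H w v := lab (h w) v.
(* The new row is cut into blocks, and from each block the bottom row of [h w] is subtracted,
   turning cosets into [bottom_rows P]. *)
pose Phi (r : level_row n) : {ffun m.-tuple bool -> level_row e} :=
  [ffun w => row_mk e (fun v => row_get r (tval w ++ v) (+) H w v)].
pose at_ (s : {ffun m.-tuple bool -> level_row e}) w :=
  if insub w is Some t then row_get (s t) else xpred0.
pose Psi (s : {ffun m.-tuple bool -> level_row e}) : level_row n :=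
  row_mk n (fun u => at_ s (take m u) (drop m u) (+) H (take m u) (drop m u)).
have PhiK : cancel Phi Psi.
  move=> r; rewrite -[RHS]row_getK; apply: eq_row_mk => u su.
  have st : size (take m u) == m by rewrite size_takel // su -mn leq_addr.
  rewrite /at_ insubT /= ffunE row_mkK ?size_drop ?su; last by lia.
  by rewrite /= cat_take_drop -addbA addbb addbF.
have PsiK : cancel Psi Phi.
  move=> s; apply/ffunP => t; rewrite ffunE -[RHS]row_getK.
  apply: eq_row_mk => v sv; rewrite row_mkK; last by rewrite size_cat size_tuple sv.
  rewrite take_size_cat ?size_tuple // drop_size_cat ?size_tuple //.
  by rewrite /at_ valK -addbA addbb addbF.
pose A := [set s : {ffun m.-tuple bool -> level_row e} in
  ffun_on (bottom_rows P)]%SET.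
have <- : #|A| = (B ^ 2 ^ m)%N.
  by rewrite finset.cardsE card_ffun_on card_tuple card_bool.
rewrite -(on_card_preimset (f := Phi)); last by apply: onW_bij; exists Psi.
apply: eq_card => r; rewrite !finset.inE.
have key w : size w = m -> (portrait_perm d (fun v => glue_row f r (w ++ v)) \in P) =
    (row_mk e (fun v => row_get r (w ++ v) (+) H w v) \in bottom_rows P).
  move=> sw; have [hwP hwE] := hP _ sw.
  rewrite mem_bottom_rows -[RHS](groupMr _ hwP).
  suff -> : portrait_perm d (fun v => glue_row f r (w ++ v)) =
    (row_aut e e (fun v => row_get r (w ++ v) (+) H w v) * h w)%g by [].
  apply: finAut_eq; rewrite ?groupM ?row_aut_in ?portrait_in_finAut ?PGm // => v.
  rewrite ltnS => sv; rewrite label_row_mul ?PGm // label_portrait //.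
  have -> : glue_row f r (w ++ v) =
      if size v == e then row_get r (w ++ v) else f (w ++ v).
    by rewrite /glue_row size_cat sw -[in RHS](eqn_add2l m) mn.
  case: eqP => [_|/eqP ne].
    by rewrite -addbA addbb addbF.
  by rewrite hwE // ltn_neqAle ne.
apply/asboolP/ffun_onP => [rA t|rA w].
  by rewrite ffunE -key ?size_tuple //; apply: rA; rewrite size_tuple; lia.
rewrite leq_eqVlt => /orP[/eqP sw|sw].
  have sm : size w == m by apply/eqP; lia.
  by rewrite key; [have := rA (Tuple sm); rewrite ffunE|exact/eqP].
rewrite (@eq_portrait _ (fun v => f (w ++ v))) ?fadm // => v sv.
by rewrite /glue_row size_cat ltn_eqF //; lia.
Qed.

Lemma card_dep_set (T U : finType) (Q : pred T) (R : T -> pred U) :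
  #|[set x : T * U | Q x.1 && R x.1 x.2]%SET| =
  (\sum_(t | Q t) #|[set u | R t u]%SET|)%N.
Proof.
rewrite -sum1_card (eq_bigl (fun x => Q x.1 && R x.1 x.2)) => [|x]; last first.
  by rewrite finset.inE.
rewrite -(pair_big_dep Q R (fun _ _ => 1%N)) /=; apply: eq_bigr => t _.
by rewrite -sum1_card; apply: eq_bigl => u; rewrite finset.inE.
Qed.

(** Every admissible portrait of height [n] has the same number of extensions to height [M]. The
    exponents $2^{k-e}$, $n\le k<M$, sum to $2^{M-e}-2^{n-e}$; cross-multiplying avoids division. *)
Lemma card_admissible n M (R : pred (finite_portrait n)) : (d <= n <= M)%N ->
  (#|[set q : finite_portrait M | admissible M (pre_get q) && R (pre_mk n (pre_get q))]%SET|
     * B ^ 2 ^ (n - e) =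
   #|[set t : finite_portrait n | admissible n (pre_get t) && R t]%SET| * B ^ 2 ^ (M - e))%N.
Proof.
case/andP=> dn; elim: M => [|M IH]; first by rewrite leqNgt (leq_trans _ dn).
rewrite leq_eqVlt => /orP[/eqP <-|].
  congr (_ * _)%N; apply: eq_card => q; rewrite !finset.inE; by rewrite pre_getK.
rewrite ltnS => nM; have dM := leq_trans dn nM.
pose Q (q : finite_portrait M) := admissible M (pre_get q) && R (pre_mk n (pre_get q)).
pose S (q : finite_portrait M) (r : level_row M) := admissible M.+1 (glue_row (pre_get q) r).
have -> : [set q : finite_portrait M.+1 |
    admissible M.+1 (pre_get q) && R (pre_mk n (pre_get q))]%SET =
    [set x : finite_portrait M * level_row M | Q x.1 && S x.1 x.2]%SET.
  apply/finset.setP => -[q r]; rewrite !finset.inE /Q /S /=.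
  have E w : (size w < M)%N -> glue_row (pre_get q) r w = pre_get q w.
    by move=> sw; rewrite /glue_row ltn_eqF.
  rewrite (@eq_pre_mk n _ (pre_get q)) => [|w wn]; last first.
    by rewrite E // (leq_trans wn).
  rewrite andbAC; case: (R _); rewrite ?andbF ?andbT //.
  case: (boolP (admissible M.+1 _)) => [H|]; last by rewrite andbF.
  by rewrite andbT -(eq_admissible E) (admissible_leq _ H).
rewrite card_dep_set (eq_bigr (fun=> (B ^ 2 ^ (M - e))%N)) => [|q /andP[qa _]].
  rewrite sum_nat_const mulnAC.
  have -> : #|Q| = #|[set q | Q q]%SET| by apply: eq_card => q; rewrite finset.inE.
  rewrite IH // -mulnA -expnD addnn -mul2n -expnS subSn //; exact: ltnW.
exact: card_extensions.
Qed.

End Admissible.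

(** * The metric *)

Definition agree n f f' : Prop := forall w, (size w < n)%N -> f w = f' w.

Lemma agree_leq m n f f' : (m <= n)%N -> agree n f f' -> agree m f f'.
Proof. by move=> mn E w sw; apply: E; exact: leq_trans mn. Qed.

Lemma agreeP n f f' : reflect (agree n f f') (pre_mk n f == pre_mk n f').
Proof.
apply: (iffP eqP) => [E w sw|]; last exact: eq_pre_mk.
by rewrite -(pre_mkK f sw) E pre_mkK.
Qed.

Lemma agree_levelP n (g h : treeAut) :
  agree n (label g) (label h) <-> forall u, size u = n -> g u = h u.
Proof.
split=> E.
  by move=> u su; rewrite !treeAut_pact; apply: eq_pact => w; rewrite su; exact: E.
have gh w : (size w <= n)%N -> g w = h w.
  (* Shorter words are padded with zeros to length [n], and images of prefixes are compared. *)
  move=> sw; have := E (w ++ nseq (n - size w) false).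
  rewrite size_cat size_nseq subnKC // => /(_ erefl).
  rewrite !treeAut_pact !pact_cat => /eqP.
  by rewrite eqseq_cat ?size_pact // => /andP[/eqP].
move=> w sw; apply: label_eq_pact => [|x]; rewrite -?treeAut_pact -?gh //.
- exact: ltnW.
- by rewrite size_rcons.
Qed.

Lemma mem_level_coset n (g k : treeAut) :
  [set (g * h)%g | h in level_stab n]%classic k <-> agree n (label g) (label k).
Proof.
rewrite agree_levelP; split=> [[h hn <-] u su|E].
  by rewrite -[in LHS](hn u su).
exists (g^-1 * k)%g; last by rewrite mulKVg.
move=> u su /=; change ((g^-1)%g (k u) = u); rewrite -E //.
by change ((g^-1 * g)%g u = u); rewrite mulVg.
Qed.

(** Cosets of the level stabilizer correspond to the portraits of height [n]. *)
Lemma group_index_level_stab n : group_index (level_stab n) = (2 ^ (2 ^ n - 1))%N.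
Proof.
pose F (t : finite_portrait n) : set treeAut :=
  [set (portraitAut (pre_get t) * h)%g | h in level_stab n]%classic.
have FP t k : F t k <-> pre_mk n (label k) = t.
  rewrite /F mem_level_coset; split=> [E|<-].
    rewrite -[RHS]pre_getK; apply: eq_pre_mk => w sw.
    by rewrite -E // label_portraitAut.
  by move=> w sw; rewrite label_portraitAut pre_mkK.
have Finj : injective F.
  move=> s t E; have /FP : F t (portraitAut (pre_get s)).
    rewrite -E; apply/FP; rewrite -[RHS]pre_getK; apply: eq_pre_mk => w _.
    exact: label_portraitAut.
  move=> <-; rewrite -[LHS]pre_getK; apply: eq_pre_mk => w _.
  exact/esym/label_portraitAut.
rewrite /group_index.
have -> : [set [set (g * h)%g | h in level_stab n] | g in [set: treeAut]]%classic =
    [set F t | t in [set: finite_portrait n]]%classic.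
  apply/seteqP; split=> [_ [g _ <-]|_ [t _ <-]].
    exists (pre_mk n (label g)) => //; apply/seteqP; split=> k.
      by move/FP => E; apply/mem_level_coset/agreeP; rewrite E.
    by move/mem_level_coset/agreeP => /eqP E; apply/FP.
  by exists (portraitAut (pre_get t)).
rewrite fset_set_image; last exact: (@finite_finset (finite_portrait n)).
rewrite card_imfset //= -card_finite_portrait cardE.
apply/perm_size/uniq_perm; rewrite ?fset_uniq ?enum_uniq // => t.
rewrite mem_enum in_fset_set; last exact: (@finite_finset (finite_portrait n)).
exact: mem_set.
Qed.

Section Metric.
Variable R : realType.

(** The distance of two automorphisms whose labels first differ on level [n]. *)
Definition rho n : R := (2 ^ (2 ^ n - 1))%:R^-1.

Lemma rho_gt0 n : 0 < rho n.
Proof. by rewrite invr_gt0 ltr0n expn_gt0. Qed.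

Lemma rho_le m n : (rho n <= rho m) = (m <= n)%N.
Proof.
rewrite lef_pV2 ?posrE ?ltr0n ?expn_gt0 // ler_nat leq_exp2l //.
by rewrite leq_sub2rE ?expn_gt0 // leq_exp2l.
Qed.

Lemma aut_distxx (g : treeAut) : aut_dist R g g = 0.
Proof. by rewrite /aut_dist eqxx. Qed.

Lemma aut_dist_neq (g h : treeAut) : g <> h -> exists n,
  [/\ aut_dist R g h = rho n, agree n (label g) (label h) &
      ~ agree n.+1 (label g) (label h)].
Proof.
move=> gh; rewrite /aut_dist; case: eqP => // _.
have ex : exists n, `[< labels_differ g h n >].
  apply/not_existsP => H; apply: gh; apply: treeAut_label_inj => w.
  apply: contrapT => ne; apply: (H (size w)); apply/asboolP; by exists w.
pose n := ex_minn ex.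
have [nd nmin] : labels_differ g h n /\ forall j, labels_differ g h j -> (n <= j)%N.
  rewrite /n; case: ex_minnP => m /asboolP md mmin; split=> // j jd.
  by apply: mmin; apply/asboolP.
have -> : first_diff_level g h = n.
  apply: xget_unique; first by [].
  by move=> m [md mmin]; apply/eqP; rewrite eqn_leq mmin // nmin.
exists n; split; first by rewrite group_index_level_stab.
  move=> w sw; apply: contrapT => ne.
  have : labels_differ g h (size w) by exists w.
  by move/nmin; rewrite leqNgt sw.
by case: nd => u su ne /(_ u); rewrite su => /(_ (ltnSn _)).
Qed.

Lemma aut_dist_le n (g h : treeAut) :
  aut_dist R g h <= rho n <-> agree n (label g) (label h).
Proof.
have [->|/eqP gh] := eqVneq g h.
  by rewrite aut_distxx; split=> // _; exact/ltW/rho_gt0.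
have [m [-> ma mn]] := aut_dist_neq gh; rewrite rho_le; split=> [nm|na].
  exact: agree_leq ma.
by rewrite leqNgt; apply/negP => mn'; apply: mn; exact: agree_leq na.
Qed.

Lemma aut_dist_eq n (g h : treeAut) :
  agree n (label g) (label h) -> ~ agree n.+1 (label g) (label h) ->
  aut_dist R g h = rho n.
Proof.
move=> na nn; have gh : g <> h by move=> E; apply: nn; rewrite E.
have [m [-> ma mn]] := aut_dist_neq gh.
suff -> : m = n by [].
apply/eqP; rewrite eqn_leq; apply/andP.
split; rewrite leqNgt; apply/negP => lt.
  by apply: nn; exact: agree_leq ma.
by apply: mn; exact: agree_leq na.
Qed.

Local Notation diam := (diameter (@aut_dist R)).

Lemma diameter_ge0 U : (0 <= diam U)%E.
Proof. by apply: ereal_sup_ubound; left. Qed.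

Lemma diameter_ge U g h : U g -> U h -> ((aut_dist R g h)%:E <= diam U)%E.
Proof. by move=> Ug Uh; apply: ereal_sup_ubound; right; exists (g, h). Qed.

Definition cylindrical n (U : set treeAut) : Prop :=
  forall g h, U g -> U h -> agree n (label g) (label h).

Lemma diameter_le n U : (diam U <= (rho n)%:E)%E <-> cylindrical n U.
Proof.
split=> [H g h Ug Uh|H].
  apply/aut_dist_le; rewrite -lee_fin; exact: le_trans (diameter_ge Ug Uh) H.
apply: ge_ereal_sup => _ [->|[[g h] [/= Ug Uh] <-]].
  by rewrite lee_fin ltW ?rho_gt0.
by rewrite lee_fin; apply/aut_dist_le; exact: H.
Qed.

Lemma rho_le_diameter n U : cylindrical n U -> ~ cylindrical n.+1 U ->
  ((rho n)%:E <= diam U)%E.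
Proof.
move=> Un; move/existsNP => [g /existsNP[h /not_implyP[Ug /not_implyP[Uh nn]]]].
by rewrite -(aut_dist_eq (Un _ _ Ug Uh) nn) diameter_ge.
Qed.

(** The first case is that of at most one point; in the second, [m] is the greatest height and the
    diameter is [rho m]. *)
Lemma cylindrical_split n U : cylindrical n U ->
  (forall m, cylindrical m U) \/
  exists2 m, (n <= m)%N & cylindrical m U /\ ~ cylindrical m.+1 U.
Proof.
move=> Un; have [H|/existsNP[k nk]] := pselect (forall m, cylindrical m U).
  by left.
right.
have ex : exists k, ~~ `[< cylindrical k U >] by exists k; apply/asboolPn.
case: (ex_minnP ex) => m /asboolPn nm mmin.
have nltm : (n < m)%N.
  rewrite ltnNge; apply/negP => mn; apply: nm => g h Ug Uh.
  exact: agree_leq (Un _ _ Ug Uh).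
case: m nm mmin nltm => // m nm mmin nm1; exists m => //; split=> //.
apply: contrapT => /asboolPn /mmin; by rewrite ltnn.
Qed.

End Metric.

(** * Hausdorff dimension *)

Section Dimension.
Variables (R : realType) (e : nat).
Local Notation d := e.+1.
Variable P : {group {perm d.-bseq bool}}.
Hypotheses (PG : pattern_group P) (Pess : essential P).
Variable b : nat.
Hypothesis cB : #|bottom_rows P| = (2 ^ b)%N.
Local Notation H := (fin_constrained P).
Local Notation diam := (diameter (@aut_dist R)).

Lemma fin_constrainedP (g : treeAut) :
  H g <-> forall M, admissible P M (label g).
Proof.
split=> [Hg M|Hg w].
  apply/asboolP => w _; have [p pP pE] := Hg w.
  suff -> : portrait_perm d (fun v => label g (w ++ v)) = p by [].
  apply: finAut_eq; rewrite ?portrait_in_finAut //.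
    exact: (fintype.subsetP PG).
  by move=> v sv; rewrite label_portrait // pE.
have /asboolP/(_ w (leqnn _)) wP := Hg (size w + d)%N.
by exists (portrait_perm d (fun v => label g (w ++ v))) => // v /label_portrait ->.
Qed.

(** König's lemma: if no finite part of the cover suffices, one descends through cylinders that are
    not finitely covered; their limit lies in the group, so it is covered by a single cylinder, a
    contradiction. *)
Lemma admissible_compact (c : nat -> seq bool -> bool) (m : nat -> nat) :
  (forall g, H g -> exists i, agree (m i) (label g) (c i)) ->
  exists k M, forall f, admissible P M f ->
    exists i, [/\ (i < k)%N, (m i <= M)%N & agree (m i) f (c i)].
Proof.
move=> cov; pose fin n f0 := exists k M, forall f, agree n f f0 ->
  admissible P M f -> exists i, [/\ (i < k)%N, (m i <= M)%N & agree (m i) f (c i)].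
suff [k [M kM]] : fin 0%N (fun=> false).
  by exists k, M => f; exact: kM.
apply: contrapT => nfin.
have step n f0 : ~ fin n f0 -> exists f1, agree n f1 f0 /\ ~ fin n.+1 f1.
  move=> nf; apply: contrapT => nx; apply: nf.
  have fr (r : level_row n) : fin n.+1 (glue_row f0 r).
    apply: contrapT => nr; apply: nx; exists (glue_row f0 r); split=> // w sw.
    by rewrite /glue_row ltn_eqF.
  have [k Hk] := choice fr; have [M HM] := choice Hk.
  (* There are finitely many rows to extend by, so the bounds of all extensions have a maximum. *)
  exists (\max_r k r)%N, (\max_r M r)%N => f ff0 fM.
  pose r := row_mk n f.
  have fr1 : agree n.+1 f (glue_row f0 r).
    move=> w; rewrite ltnS leq_eqVlt /glue_row; case: eqP => [sw _|_ /ff0 //].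
    by rewrite row_mkK.
  have rM : (M r <= \max_r M r)%N := leq_bigmax r.
  have [i [ik iM ai]] := HM r f fr1 (admissible_leq rM fM).
  exists i; split=> //; last exact: leq_trans rM.
  exact: leq_trans ik (leq_bigmax r).
have step' (x : nat * (seq bool -> bool)) : exists f1,
    ~ fin x.1 x.2 -> agree x.1 f1 x.2 /\ ~ fin x.1.+1 f1.
  have [fx|nx] := pselect (fin x.1 x.2); first by exists x.2.
  by have [f1 Hf1] := step _ _ nx; exists f1.
have [F HF] := choice step'.
pose fix path n := if n is n'.+1 then F (n', path n') else (fun=> false).
have pathN n : ~ fin n (path n).
  by elim: n => // n IH; have [] := HF (n, path n) IH.
have pathA n k : agree n (path (n + k)%N) (path n).
  elim: k => [|k IH] w sw; first by rewrite addn0.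
  rewrite addnS -IH //; have [A _] := HF ((n + k)%N, path (n + k)%N) (@pathN _).
  by apply: A => /=; rewrite (leq_trans sw) // leq_addr.
pose g w := path (size w).+1 w.
have gA n : agree n g (path n).
  move=> w sw; rewrite /g -(subnKC sw); apply/esym; exact: pathA.
(* Otherwise the cylinder of [path M] would contain no admissible portrait and be finitely covered
   vacuously. *)
have gadm M : admissible P M g.
  apply: contrapT => /negP nadm; apply: (@pathN M).
  exists 0%N, M => f fM fadm; exfalso; move/negP: nadm; apply.
  by rewrite (@eq_admissible _ P M g f) // => w sw; rewrite fM // (gA M).
have [|i ai] := cov (portraitAut g).
  apply/fin_constrainedP => M; rewrite (@eq_admissible _ P M _ g) ?gadm // => w _.
  exact: label_portraitAut.
apply: (@pathN (m i)); exists i.+1, (m i) => f fp fadm.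
exists i; split=> // w sw; rewrite fp // -(gA (m i)) // -ai //.
exact/esym/label_portraitAut.
Qed.

(* Up to a constant, the share of the group in a cylinder of height [n]. *)
Definition weight n : R := (2 ^ (b * 2 ^ (n - e)))%:R^-1.

(** Comparison with height [d], where $2^{d-e}=2$ accounts for the factor and the trivial portrait
    is admissible. *)
Lemma card_admissible_ge M : (d <= M)%N -> (2 ^ (b * 2 ^ (M - e)) <=
  #|[set q : finite_portrait M | admissible P M (pre_get q)]%SET| * 2 ^ (b * 2))%N.
Proof.
move=> dM; have := @card_admissible e P PG Pess d M predT.
rewrite leqnn dM => /(_ erefl); rewrite cB -!expnM subSnn expn1.
under eq_finset do rewrite andbT; move=> ->.
rewrite -[X in (X <= _)%N]mul1n leq_mul2r; apply/orP; right.
rewrite card_gt0; apply/set0Pn; exists (pre_mk d (fun=> false)).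
rewrite finset.inE andbT; apply/asboolP => w sw.
rewrite (@eq_portrait _ _ (fun v => (size v == 0)%N && false)).
  by have := row_aut0 e 0; rewrite /row_aut => ->.
move=> v sv; rewrite pre_mkK ?andbF //.
by rewrite size_cat; move: sw sv; lia.
Qed.

Lemma card_admissible_le M : (d <= M)%N ->
  (#|[set q : finite_portrait M | admissible P M (pre_get q)]%SET| <=
   #|{: finite_portrait d}| * 2 ^ (b * 2 ^ (M - e)))%N.
Proof.
move=> dM; have := @card_admissible e P PG Pess d M predT.
rewrite leqnn dM => /(_ erefl); rewrite cB -!expnM.
under eq_finset do rewrite andbT; move=> E.
apply: (@leq_trans (#|[set q : finite_portrait M | admissible P M (pre_get q)]%SET|
   * 2 ^ (b * 2 ^ (d - e)))); first by rewrite leq_pmulr // expn_gt0.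
by rewrite E leq_mul2r max_card orbT.
Qed.

Lemma card_cylinder_le n M f : (d <= n <= M)%N ->
  (#|[set q : finite_portrait M | admissible P M (pre_get q) &&
      (pre_mk n (pre_get q) == pre_mk n f)]%SET| * 2 ^ (b * 2 ^ (n - e)) <=
   2 ^ (b * 2 ^ (M - e)))%N.
Proof.
move=> nM; have := @card_admissible e P PG Pess n M (pred1 (pre_mk n f)) nM.
rewrite cB -!expnM /= => ->; rewrite -[X in (_ <= X)%N]mul1n leq_mul2r.
apply/orP; right; rewrite -(finset.cards1 (pre_mk n f)).
by apply/subset_leq_card/fintype.subsetP => t; rewrite !finset.inE => /andP[].
Qed.

(** * The lower bound for the dimension *)

Lemma cover_weight (c : nat -> seq bool -> bool) (m : nat -> nat) :
  (forall i, d <= m i)%N ->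
  (forall g, H g -> exists i, agree (m i) (label g) (c i)) ->
  exists k, (2 ^ (b * 2))%:R^-1 <= \sum_(i < k) weight (m i).
Proof.
move=> dm /admissible_compact[k [M0 HM]]; exists k.
pose M := maxn d M0; have dM : (d <= M)%N := leq_maxl _ _.
have M0M : (M0 <= M)%N := leq_maxr _ _.
pose S := [set q : finite_portrait M | admissible P M (pre_get q)]%SET.
pose C i := [set q : finite_portrait M | admissible P M (pre_get q) &&
      (pre_mk (m i) (pre_get q) == pre_mk (m i) (c i))]%SET.
(* Cylinders of height above [M] may be dropped: those of height at most [M0] already catch every
   admissible portrait. *)
have union : (#|S| <= \sum_(i < k | (m i <= M)%N) #|C i|)%N.
  rewrite -sum1_card.
  have E : (\sum_(i < k | (m i <= M)%N) #|C i| = \sum_(q in S)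
      \sum_(i < k | (m i <= M)%N) (pre_mk (m i) (pre_get q) == pre_mk (m i) (c i)))%N.
    rewrite exchange_big /=; apply: eq_bigr => i _.
    rewrite -sum1_card big_mkcond [RHS]big_mkcond /=; apply: eq_bigr => q _.
    by rewrite !finset.inE; case: (admissible _ _ _) => //=; case: eqP.
  rewrite E; apply: leq_sum => q; rewrite finset.inE => qM.
  have [i [ik iM ai]] := HM _ (admissible_leq M0M qM).
  rewrite (bigD1 (Ordinal ik)) /=; last exact: leq_trans M0M.
  by move/agreeP: ai => ->.
pose X : R := (2 ^ (b * 2 ^ (M - e)))%:R.
have X0 : 0 < X by rewrite ltr0n expn_gt0.
have B0 : 0 < (2 ^ (b * 2))%:R :> R by rewrite ltr0n expn_gt0.
rewrite -(ler_pM2l X0); apply: (@le_trans _ _ #|S|%:R).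
  by rewrite ler_pdivrMr // -natrM ler_nat card_admissible_ge.
apply: (@le_trans _ _ (\sum_(i < k | (m i <= M)%N) #|C i|%:R)).
  by rewrite -natr_sum ler_nat.
rewrite mulr_sumr big_mkcond; apply: ler_sum => i _; case: ifP => iM.
  rewrite ler_pdivlMr ?ltr0n ?expn_gt0 // -natrM ler_nat.
  by apply: card_cylinder_le; rewrite dm iM.
by rewrite mulr_ge0 ?ltW // invr_gt0 ltr0n expn_gt0.
Qed.

Lemma weight_small eps : (0 < b)%N -> 0 < eps -> exists2 n, (d <= n)%N & weight n <= eps.
Proof.
move=> b0 eps0; pose k := Num.trunc eps^-1; exists (d + k)%N; first exact: leq_addr.
rewrite -[leRHS]invrK lef_pV2 ?posrE ?invr_gt0 // ?ltr0n ?expn_gt0 //.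
apply/ltW/(lt_le_trans (truncnS_gt _)); rewrite ler_nat -/k.
have -> : (d + k - e = k.+1)%N by lia.
apply: leq_trans (ltnW (ltn_expl _ (ltnSn 1))) _ => //.
rewrite leq_exp2l // (leq_trans (ltnW (ltn_expl _ (ltnSn 1)))) //.
by rewrite leq_pmull.
Qed.

(** On exponents of 2: $s(2^n-1)\le s2^e2^{n-e}\le b2^{n-e}$. *)
Lemma weight_rho n s : (d <= n)%N -> 0 < s -> s * 2 ^+ e <= b%:R ->
  weight n <= rho R n `^ s.
Proof.
move=> dn s0 sb; have rhoE : rho R n = 2 `^ (- (2 ^ n - 1)%:R).
  by rewrite powRN powR_mulrn // -natrX.
rewrite rhoE -powRrM /weight natrX -powR_mulrn // -powRN ler_powR ?ler1n //.
rewrite mulNr lerN2; apply: (@le_trans _ _ ((2 ^ n)%N%:R * s)).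
  by rewrite ler_pM2r // ler_nat leq_subr.
have -> : (2 ^ n)%N%:R * s = s * 2 ^+ e * 2 ^+ (n - e).
  by rewrite -[n in LHS](subnK (ltnW dn)) natrX exprD; ring.
by rewrite natrM natrX ler_wpM2r // exprn_ge0.
Qed.

(** A piece is enclosed in the smallest cylinder containing it. A piece of diameter zero has none,
    so a cylinder of weight at most [eps] is taken instead. *)
Lemma cover_piece (U : set treeAut) s eps : (0 < b)%N -> 0 < s ->
  s * 2 ^+ e <= b%:R -> 0 < eps -> (diam U <= (rho R d)%:E)%E ->
  exists n, [/\ (d <= n)%N, cylindrical n U &
    ((weight n)%:E <= diam U `^ s + eps%:E)%E].
Proof.
move=> b0 s0 sb eps0 /diameter_le /cylindrical_split[Ua|[n dn [Un nUn]]].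
  have [n dn weps] := weight_small b0 eps0; exists n; split=> //.
  by rewrite (le_trans (y := eps%:E)) ?lee_fin // leeDr // poweR_ge0.
exists n; split=> //; rewrite (le_trans (y := (diam U `^ s)%E)) //; last first.
  by rewrite leeDl // lee_fin ltW.
rewrite (le_trans (y := ((rho R n)%:E `^ s)%E)) //.
  by rewrite poweR_EFin lee_fin weight_rho.
have rhod := rho_le_diameter R Un nUn.
apply: gt0_ler_poweR; rewrite ?(ltW s0) // in_itv /= ?leey ?andbT.
  by rewrite lee_fin ltW ?rho_gt0.
exact: diameter_ge0.
Qed.

Lemma sum_half k : \sum_(i < k) (2^-1 : R) ^+ i.+1 = 1 - 2^-1 ^+ k.
Proof.
elim: k => [|k IH]; first by rewrite big_ord0 expr0 subrr.
by rewrite big_ord_recr /= IH exprS; lra.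
Qed.

(** The scale [rho R d] forces all cylinders to have height at least [d], where the counting is
    valid. The errors $\varepsilon 2^{-i-1}$ sum to at most $\varepsilon$. *)
Lemma hausdorff_premeasure_ge s : (0 < b)%N -> 0 < s -> s * 2 ^+ e <= b%:R ->
  (((2 ^ (b * 2))%:R^-1)%:E <= hausdorff_premeasure (@aut_dist R) s (rho R d) H)%E.
Proof.
move=> b0 s0 sb; apply/ereal_infP => _ [U [HU dU] <-].
apply/lee_addgt0Pr => eps eps0.
have half0 i : 0 < (2^-1 : R) ^+ i.+1 by rewrite exprn_gt0 // invr_gt0.
have [m Hm] := choice (fun i => cover_piece b0 s0 sb
  (mulr_gt0 eps0 (half0 i)) (dU i)).
have ctr i : exists f, forall g, U i g -> agree (m i) (label g) f.
  have [[g Ug]|nU] := pselect (exists g, U i g).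
    by exists (label g) => h Uh; have [_ cyl _] := Hm i; exact: cyl.
  by exists (fun=> false) => g Ug; case: nU; exists g.
have [c Hc] := choice ctr.
have [|g Hg|k Hk] := @cover_weight c m.
- by move=> i; have [] := Hm i.
- by have [i _ Ui] := HU _ Hg; exists i; exact: Hc.
rewrite (le_trans (y := (\sum_(i < k) (weight (m i))%:E)%E)) //.
  by rewrite sumEFin lee_fin.
rewrite (le_trans (y := (\sum_(i < k) (diam (U i) `^ s + (eps * 2^-1 ^+ i.+1)%:E))%E)) //.
  by apply: lee_sum => i _; have [] := Hm i.
rewrite big_split /=; apply: leeD.
  rewrite -(big_mkord xpredT (fun i => diam (U i) `^ s)%E).
  by apply: nneseries_lim_ge => i _ _; exact: poweR_ge0.
rewrite sumEFin lee_fin -mulr_sumr sum_half.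
by rewrite (ler_piMr (ltW eps0)) // gerBl exprn_ge0.
Qed.

Lemma hausdorff_measure_neq0 s : (0 < b)%N -> 0 < s -> s * 2 ^+ e <= b%:R ->
  hausdorff_measure (@aut_dist R) s H <> 0%E.
Proof.
move=> b0 s0 sb E; have := hausdorff_premeasure_ge b0 s0 sb.
apply/negP; rewrite -ltNge (@le_lt_trans _ _ 0%E) ?lte_fin ?invr_gt0 ?ltr0n ?expn_gt0 //.
rewrite -E; apply: ereal_sup_ubound; exists (rho R d) => //; exact: rho_gt0.
Qed.

(** * The upper bound for the dimension *)

Lemma rho_small delta : 0 < delta -> exists n0, forall n, (n0 <= n)%N -> rho R n <= delta.
Proof.
move=> delta0; exists (Num.trunc delta^-1).+1 => n nn.
rewrite -[leRHS]invrK lef_pV2 ?posrE ?invr_gt0 // ?ltr0n ?expn_gt0 //.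
apply/ltW/(lt_le_trans (truncnS_gt _)); rewrite ler_nat (leq_trans nn) //.
apply: (@leq_trans (2 ^ n - 1)%N); first by have := ltn_expl n (ltnSn 1); lia.
exact: ltnW (ltn_expl _ (ltnSn 1)).
Qed.

(** By $1+x\le e^x$ it is enough that $a2^n\ln 2\ge C/\varepsilon$, which follows from $2^n>n$ for
    large [n]. *)
Lemma decay (C a eps : R) : 0 < C -> 0 < a -> 0 < eps ->
  exists n0, forall n, (n0 <= n)%N -> C * 2 `^ (- (a * 2 ^+ n)) <= eps.
Proof.
move=> C0 a0 eps0; have l2 : 0 < ln (2 : R) by rewrite ln_gt0 // ltr1n.
have al : 0 < a * ln 2 by exact: mulr_gt0.
exists (Num.trunc (C / eps / (a * ln 2))).+1 => n nn.
rewrite powRN ler_pdivrMr ?powR_gt0 // mulrC -ler_pdivrMr //.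
rewrite /powR (negbTE (lt0r_neq0 _)) //.
apply: le_trans (expR_ge1Dx _); apply: (@le_trans _ _ (a * 2 ^+ n * ln 2)); last first.
  by rewrite lerDr.
rewrite mulrAC -ler_pdivrMl // mulrC; apply/ltW/(lt_le_trans (truncnS_gt _)).
by rewrite -natrX ler_nat (leq_trans nn) // ltnW // ltn_expl.
Qed.

Lemma sum_ltn_const (x : R) N k :
  \sum_(0 <= i < k) (if (i < N)%N then x else 0) = x *+ minn k N.
Proof.
elim: k => [|k IH]; first by rewrite big_nil min0n mulr0n.
rewrite big_nat_recr //= IH; case: ltnP => kN.
  by rewrite (minn_idPl kN) mulrSr.
by rewrite (minn_idPr (leqW kN)) addr0.
Qed.

Lemma hausdorff_premeasure_le s delta eps : 0 < s -> b%:R < s * 2 ^+ e ->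
  0 < delta -> 0 < eps ->
  (hausdorff_premeasure (@aut_dist R) s delta H <= eps%:E)%E.
Proof.
move=> s0 sb delta0 eps0.
pose K : R := (#|{: finite_portrait d}|)%:R.
have K0 : 0 < K by rewrite ltr0n card_finite_portrait expn_gt0.
(* With at most $K2^{b2^{n-e}}$ cylinders, the sum is at most
   $K2^{b2^{n-e}}2^{-s(2^n-1)}=K2^s\,2^{-(s2^e-b)2^{n-e}}$, to which [decay] applies at [n - e]. *)
have C0 : 0 < K * 2 `^ s by rewrite mulr_gt0 // powR_gt0.
have a0 : 0 < s * 2 ^+ e - b%:R by rewrite subr_gt0.
have [n1 Hn1] := decay C0 a0 eps0.
have [n2 Hn2] := rho_small delta0.
pose n := maxn d (maxn (n1 + e) n2).
have dn : (d <= n)%N by rewrite leq_maxl.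
have n1n : (n1 <= n - e)%N by rewrite leq_subRL ?(ltnW dn) // addnC /n !leq_max leqnn !orbT.
have n2n : (n2 <= n)%N by rewrite /n !leq_max leqnn !orbT.
pose S := [set q : finite_portrait n | admissible P n (pre_get q)]%SET.
(* One cylinder for each admissible portrait of height [n], then empty sets, which contribute
   nothing since [s] is positive. *)
pose U i : set treeAut := fun g =>
  (i < #|S|)%N /\ pre_mk n (label g) = nth (pre_mk n xpred0) (enum S) i.
have cyl i : cylindrical n (U i).
  by move=> g h [_ Eg] [_ Eh]; apply/agreeP; rewrite Eg Eh.
have dU i : (diam (U i) <= (rho R n)%:E)%E by apply/diameter_le.
have dU0 i : (#|S| <= i)%N -> diam (U i) = 0%E.
  move=> Si; apply/eqP; rewrite eq_le diameter_ge0 andbT.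
  apply/ereal_supP => y [->//|[[g h] [/= [iS _] _] _]].
  by rewrite ltnNge Si in iS.
apply: (@le_trans _ _ (\sum_(0 <= i <oo) diam (U i) `^ s)%E).
  apply: ereal_inf_lbound; exists U => //; split=> [g Hg|i].
    have gS : pre_mk n (label g) \in S.
      rewrite finset.inE (@eq_admissible _ P n _ (label g)).
        by have /fin_constrainedP := Hg.
      by move=> w sw; rewrite pre_mkK.
    exists (index (pre_mk n (label g)) (enum S)) => //; split.
      by rewrite cardE index_mem mem_enum.
    by rewrite nth_index // mem_enum.
  by rewrite (le_trans (dU i)) // lee_fin Hn2.
apply: lime_le.
  by apply: is_cvg_nneseries => i _ _; exact: poweR_ge0.
apply: nearW => k /=.
have rs0 : 0 <= rho R n `^ s by exact: powR_ge0.
apply: (@le_trans _ _ (\sum_(0 <= i < k) (if (i < #|S|)%N then rho R n `^ s else 0)%:E)%E).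
  apply: lee_sum => i _; case: ltnP => iS.
    rewrite -poweR_EFin; apply: gt0_ler_poweR; rewrite ?(ltW s0) // in_itv /= ?leey ?andbT.
      exact: diameter_ge0.
    by rewrite lee_fin ltW ?rho_gt0.
  by rewrite dU0 // poweR0r // gt_eqF.
rewrite sumEFin lee_fin; apply: (@le_trans _ _ (#|S|%:R * rho R n `^ s)).
  by rewrite sum_ltn_const mulr_natl ler_wpMn2l // geq_minr.
apply: le_trans (Hn1 _ n1n).
have -> : rho R n = 2 `^ (- (2 ^ n - 1)%:R).
  by rewrite powRN powR_mulrn // -natrX.
apply: (@le_trans _ _ (K * 2 ^+ (b * 2 ^ (n - e)) * 2 `^ (- (2 ^ n - 1)%:R) `^ s)).
  by rewrite ler_wpM2r ?powR_ge0 // -natrX -natrM ler_nat card_admissible_le.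
rewrite -!mulrA ler_pM2l // -powRrM -powR_mulrn // -!powRD; try exact/implyP.
rewrite ler_powR ?ler1n // natrB ?expn_gt0 // natrM !natrX.
have -> : (2 : R) ^+ n = 2 ^+ e * 2 ^+ (n - e).
  by rewrite -[n in LHS](subnK (ltnW dn)) exprD mulrC.
by rewrite le_eqVlt; apply/orP; left; apply/eqP; ring.
Qed.

Lemma hausdorff_measure_eq0 s : 0 < s -> b%:R < s * 2 ^+ e ->
  hausdorff_measure (@aut_dist R) s H = 0%E.
Proof.
move=> s0 sb; apply/eqP; rewrite eq_le; apply/andP; split.
  apply/ereal_supP => _ [delta delta0 <-].
  apply/lee_addgt0Pr => eps eps0; rewrite add0e.
  exact: hausdorff_premeasure_le.
apply: (@le_trans _ _ (hausdorff_premeasure (@aut_dist R) s 1 H)).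
  apply/ereal_infP => _ [U _ <-]; apply: nneseries_ge0 => i _ _.
  exact: poweR_ge0.
by apply: ereal_sup_ubound; exists 1 => //=; exact: ltr01.
Qed.

Theorem hausdorff_dim_fin_constrained :
  hausdorff_dim (@aut_dist R) H = (b%:R / 2 ^+ e)%:E.
Proof.
have e0 : 0 < (2 : R) ^+ e by rewrite exprn_gt0.
apply/eqP; rewrite eq_le; apply/andP; split; last first.
  apply/ereal_infP => _ [s [s0 Hs] <-]; rewrite lee_fin ler_pdivrMr //.
  rewrite leNgt; apply/negP => sb; apply: (@hausdorff_measure_neq0 s) => //.
    (* Positivity of [b] comes from [0 < s * 2 ^+ e < b], so the case [b = 0] needs no separate
       lower bound. *)
    by rewrite -(ltr_nat R) (lt_trans _ sb) // mulr_gt0.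
  exact: ltW.
apply/lee_addgt0Pr => eps eps0; rewrite -EFinD; apply: ereal_inf_lbound.
exists (b%:R / 2 ^+ e + eps) => //.
have s0 : 0 < b%:R / 2 ^+ e + eps by rewrite ltr_wpDl // divr_ge0 // ltW.
split=> //; apply: hausdorff_measure_eq0 => //.
by rewrite mulrDl divfK ?gt_eqF // ltrDl mulr_gt0.
Qed.

End Dimension.

(** Both sides say that $b=2^e-1$. *)
Lemma hausdorff_dim_max (R : realType) (e : nat)
    (P : {group {perm e.+1.-bseq bool}}) :
  pattern_group P -> essential P ->
  hausdorff_dim (@aut_dist R) (fin_constrained P) = (1 - 1 / 2 ^+ e)%:E <->
  (#|bottom_rows P| * 2 = 2 ^ 2 ^ e)%N.
Proof.
move=> PG Pess; have [b _ cB] := card_bottom_rows P.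
rewrite (hausdorff_dim_fin_constrained R PG Pess cB) cB -expnSr.
have e0 : (2 : R) ^+ e != 0 by rewrite expf_neq0 // pnatr_eq0.
have -> : (1 - 1 / 2 ^+ e = (2 ^+ e - 1) / 2 ^+ e :> R) by field.
split=> [[/(mulIf (invr_neq0 e0)) E]|/(expnI (ltnSn 1)) E].
  congr (2 ^ _)%N; apply/eqP; rewrite -(eqr_nat R) natrX -addn1 natrD E.
  by rewrite subrK.
by rewrite -natrX -E -addn1 natrD addrK.
Qed.

Unset Implicit Arguments.
Set Strict Implicit.
Set Printing Implicit Defensive.

Theorem mainTheorem3 (R : realType) (d : nat) (hd : (2 <= d)%N) :
  let good (P : {group {perm d.-bseq bool}}) : Prop :=
    [/\ pattern_group P, essential P &
        hausdorff_dim (@aut_dist R) (fin_constrained P) =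
          (1 - 1 / 2 ^+ (d - 1))%:E] in
  #|[set P : {group {perm d.-bseq bool}} | `[< good P >]]%SET| = (2 ^ (d - 1))%N
  /\ forall P : {group {perm d.-bseq bool}}, good P -> maximal P (finAut d).
Proof.
case: d hd => [|e] // e0 good; rewrite ltnS in e0.
(* The good groups are parametrized by the free coefficients of the character on the levels above
   [e]. *)
have goodP P : good P <-> exists c : {ffun 'I_e -> bool}, P = level_ker_group e (extend_top c).
  rewrite /good subn1 /=; split=> [[PG Pess /(hausdorff_dim_max R PG Pess) cP]|[c ->]].
    exact: essential_level_ker.
  have ce := extend_top_e c.
  have PG := @level_ker_pattern e (extend_top c).
  have Pess := level_ker_essential ce.
  split=> //; apply/(hausdorff_dim_max R PG Pess); exact: bottom_rows_level_ker.
split=> [|P /goodP[c ->]]; last exact/level_ker_maximal/extend_top_e.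
have -> : [set P : {group {perm e.+1.-bseq bool}} | `[< good P >]]%SET =
    [set level_ker_group e (extend_top c) | c in [set: {ffun 'I_e -> bool}]]%SET.
  apply/finset.setP => P; rewrite finset.inE; apply/asboolP/imsetP.
    by move=> /goodP[c ->]; exists c; rewrite ?finset.inE.
  by move=> [c _ ->]; apply/goodP; exists c.
rewrite card_imset; last exact: level_ker_inj.
by rewrite cardsT card_ffun card_bool card_ord subn1.
Qed.
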